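(* Let $n\ge3$ and let $M>1$ be an integer. Define $$\Phi_{2M}(\mathbf x)=\mathcal B_n\big(L_{M-1}^{(n/2)}(|\cdot|^2)\,e^{-|\cdot|^2}\big)(\mathbf x).$$ Then for $\mathbf x\in\mathbb R^n\setminus\{0\}$ $$\Phi_{2M}(\mathbf x)=\mathcal B_n(e^{-|\cdot|^2})(\mathbf x)+\frac{1}{16|\mathbf x|^{n-2}}\,\gamma\Big(\frac n2-1,|\mathbf x|^2\Big)+\frac{e^{-|\mathbf x|^2}}{16}\sum_{j=0}^{M-3}\frac{L_j^{(n/2-1)}(|\mathbf x|^2)}{(j+1)(j+2)},$$ where $\gamma(a,x)=\int_0^x t^{a-1}e^{-t}\,dt$ is the lower incomplete Gamma function.
   Context: The biharmonic potential is $$\mathcal B_n f(\mathbf x)=\frac{\Gamma(n/2)}{4\pi^{n/2}(n-2)(n-4)}\int_{\mathbb R^n}\frac{f(\mathbf y)}{|\mathbf x-\mathbf y|^{n-4}}\,d\mathbf y\quad(n\ge3,\ n\ne4),$$ $$\mathcal B_4 f(\mathbf x)=-\frac{1}{8\pi^2}\int_{\mathbb R^4}\ln|\mathbf x-\mathbf y|\,f(\mathbf y)\,d\mathbf y\quad(n=4).$$ The generalized Laguerre polynomials are $$L_k^{(\gamma)}(y)=\frac{e^y y^{-\gamma}}{k!}\Big(\frac{d}{dy}\Big)^k\big(e^{-y}y^{k+\gamma}\big),\qquad\gamma>-1 .$$ The sum over $j$ is empty if $M=2$. *)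

(* Defs.v *)
From HB Require Import structures.
From mathcomp Require Export all_boot all_order all_algebra.
From mathcomp Require Export all_classical all_reals all_analysis.
Set Implicit Arguments.
Unset Strict Implicit.
Unset Printing Implicit Defensive.
Export Order.TTheory GRing.Theory Num.Theory.
Export numFieldNormedType.Exports.
Local Open Scope classical_set_scope.
Local Open Scope ring_scope.

(** A point of R^n is an [n.-tuple R]: unlike ['rV[R]_n], this type carries the
    product sigma-algebra of the library. *)

Section lebesgue_cons.
Context {R : realType} (n : nat).

Definition cons_pair (p : R * n.-tuple R) : n.+1.-tuple R :=
  [the n.+1.-tuple R of p.1 :: p.2].

Definition uncons (t : n.+1.-tuple R) : R * n.-tuple R :=
  (thead t, [tuple of behead t]).

Lemma cons_pairK : cancel cons_pair uncons.
Proof. by case=> a t; congr pair; exact/val_inj. Qed.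

Lemma measurable_cons_pair : measurable_fun setT cons_pair.
Proof.
by apply: measurable_cons; [exact: measurable_fst|exact: measurable_snd].
Qed.

Lemma measurable_uncons : measurable_fun setT uncons.
Proof.
apply: measurable_fun_pair; first exact: measurable_tnth.
exact: measurable_behead.
Qed.

Variable mu : {sigma_finite_measure set (n.-tuple R) -> \bar R}.

Definition lebesgue_cons : set (n.+1.-tuple R) -> \bar R :=
  pushforward ((@lebesgue_measure R) \x mu)%E cons_pair.

Let lebesgue_cons0 : lebesgue_cons set0 = 0%E.
Proof. by rewrite /lebesgue_cons /pushforward preimage_set0 measure0. Qed.

Let lebesgue_cons_ge0 A : (0 <= lebesgue_cons A)%E.
Proof. by rewrite /lebesgue_cons /pushforward; exact: measure_ge0. Qed.

Let lebesgue_cons_sigma_additive : semi_sigma_additive lebesgue_cons.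
Proof.
have mpre A : measurable A -> measurable (cons_pair @^-1` A).
  by move=> mA; rewrite -[X in measurable X]setTI; exact: measurable_cons_pair.
move=> F mF tF mUF; rewrite /lebesgue_cons /pushforward preimage_bigcup.
apply: measure_semi_sigma_additive.
- by move=> k; exact: mpre.
- apply/trivIsetP => /= k l _ _ kl; rewrite -preimage_setI.
  by move/trivIsetP : tF => /(_ _ _ _ _ kl) ->//; rewrite preimage_set0.
- by rewrite -preimage_bigcup; exact: mpre.
Qed.

HB.instance Definition _ := isMeasure.Build _ _ _ lebesgue_cons
  lebesgue_cons0 lebesgue_cons_ge0 lebesgue_cons_sigma_additive.

Let lebesgue_cons_sigma_finite : sigma_finite setT lebesgue_cons.
Proof.
have /sigma_finiteP[F [FT ndF Foo]] := sigma_finiteT (@lebesgue_measure R).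
have /sigma_finiteP[G [GT ndG Goo]] := sigma_finiteT mu.
exists (fun k => uncons @^-1` (F k `*` G k)).
  rewrite -preimage_bigcup -(preimage_setT uncons); congr (_ @^-1` _).
  rewrite -setXTT FT GT; apply/seteqP; split=> -[a t] /=; last first.
    by move=> [k _ [? ?]]; split; exists k.
  move=> [[k _ Fa] [l _ Gt]]; exists (maxn k l) => //; split.
  - by move: a Fa; exact/subsetPset/ndF/leq_maxl.
  - by move: t Gt; exact/subsetPset/ndG/leq_maxr.
move=> k; have [mF Fk] := Foo k; have [mG Gk] := Goo k.
have mFG : measurable (F k `*` G k) by exact: measurableX.
split; first by rewrite -[X in measurable X]setTI; exact: measurable_uncons.
rewrite /lebesgue_cons /pushforward -comp_preimage.
rewrite (_ : uncons \o cons_pair = id); last exact/funext/cons_pairK.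
by rewrite preimage_id product_measure1E// lte_mul_pinfty// ge0_fin_numE.
Qed.

HB.instance Definition _ := Measure_isSigmaFinite.Build _ _ _ lebesgue_cons
  lebesgue_cons_sigma_finite.

End lebesgue_cons.

(** Lebesgue measure on R^n: R^0 is a point of mass 1, and R^(n+1) carries the
    product measure of R x R^n, transported along [cons_pair]. *)
Fixpoint lebesgue_tuple {R : realType} n :
    {sigma_finite_measure set (n.-tuple R) -> \bar R} :=
  match n with
  | 0%N => \d_ ([tuple] : 0.-tuple R)
  | m.+1 => lebesgue_cons (lebesgue_tuple m)
  end.

Section potentials.
Context {R : realType}.

Definition origin n : n.-tuple R := [tuple 0 | i < n].

Definition edist n (x y : n.-tuple R) : R :=
  Num.sqrt (\sum_(i < n) (tnth x i - tnth y i) ^+ 2).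

Definition enorm n (x : n.-tuple R) : R :=
  Num.sqrt (\sum_(i < n) tnth x i ^+ 2).

Definition Gamma (a : R) : R :=
  \int[lebesgue_measure]_(t in `]0, +oo[) (t `^ (a - 1) * expR (- t)).

Definition lower_gamma (a x : R) : R :=
  \int[lebesgue_measure]_(t in `]0, x[) (t `^ (a - 1) * expR (- t)).

(** Rodrigues formula, meaningful for [0 < y] only. The value at [y = 0] is a
    junk value, which is harmless when [y = |x|^2] is under an integral over
    R^n, since the origin is a null set for n > 0. *)
Definition Laguerre (k : nat) (c y : R) : R :=
  expR y * y `^ (- c) / k`!%:R *
  derive1n k (fun t : R => expR (- t) * t `^ (k%:R + c)) y.

(** The integrand at [y = x] is also irrelevant. For n = 3 the exponent of the
    distance is -1, hence the integer power. *)
Definition biharmonic_potential n (f : n.-tuple R -> R) (x : n.-tuple R) : R :=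
  if n == 4%N then
    - (8 * pi ^+ 2)^-1 *
    \int[lebesgue_tuple n]_y (ln (edist x y) * f y)
  else
    Gamma (n%:R / 2) / (4 * pi `^ (n%:R / 2) * (n%:R - 2) * (n%:R - 4)) *
    \int[lebesgue_tuple n]_y (f y / edist x y ^ (n%:Z - 4)).

Definition gaussian n (y : n.-tuple R) : R := expR (- enorm y ^+ 2).

Definition Phi n M : n.-tuple R -> R :=
  biharmonic_potential
    (fun y => Laguerre M.-1 (n%:R / 2) (enorm y ^+ 2) * gaussian y).

End potentials.

(* Main.v *)
Require Import Defs.
From mathcomp Require Import measurable_realfun ring lra.
Local Open Scope classical_set_scope.
Local Open Scope ring_scope.

(** Let [c = n/2 - 1] and [G_a(y) = a^(-n/2) exp(-|y|^2/a)]. Up to the sign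
    [(-1)^j], the [j]-th derivative of [G_a] in [a] at [a = 1] is [j!] times
    [L_j^(c)(|y|^2) exp(-|y|^2)], and [L_k^(c+1)] is the sum of the [L_j^(c)] for
    [j <= k], so that it suffices to treat these derivatives one by one.

    The kernel of [B_n] is, up to an additive constant, a superposition of
    Gaussians: [(16 pi^(n/2))^-1] times the integral over [b > 0] of
    [b^(1 - n/2) (exp(-|x - y|^2/b) - exp(-1/b))], the term [exp(-1/b)] making
    the integral converge also for [n = 3] and [n = 4]. That constant does not
    matter for [j >= 1], where the density has integral 0. Since the convolution
    of [G_a] and [G_b] is [pi^(n/2) G_(a+b)], Fubini reduces the potential of the
    [j]-th derivative of [G_a] at [a = 1] to the integral over [b > 0] of
    [b (d/da)^j G_(1+b)(x)], which two integrations by parts evaluate as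
    [(d/da)^(j-2) G_1(x)]. For [j = 1] this stands for the primitive
    [- |x|^(2-n) gamma(c, |x|^2/a)] of [G_a(x)] in [a]. *)

(** * Laguerre polynomials and derivatives of the heat kernel *)

Section laguerre.
Context {R : realType}.
Implicit Types (c y r a : R) (k j : nat).

(* [lag k c = k! L_k^(c)]. *)
Fixpoint lag k c y : R :=
  if k is j.+1 then (j.+1%:R + c) * lag j c y - y * lag j (c + 1) y else 1.

(** The classical [L_(k+1)^(c+1) - L_k^(c+1) = L_(k+1)^(c)], multiplied by [(k+1)!]. The induction
    hypotheses at [c] and [c + 1] eliminate the terms with parameters [c] and [c + 3]. *)
Lemma lag_contiguous k c y :
  lag k.+1 (c + 1) y - k.+1%:R * lag k (c + 1) y = lag k.+1 c y.
Proof.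
elim: k c => [|k IH] c /=; first by ring.
have := IH (c + 1); have := IH c => /=.
set A := lag k c y; set B := lag k (c + 1) y.
set C := lag k (c + 1 + 1) y; set D := lag k _ y => h1 h2.
have h1' : (k.+1%:R + c) * A =
    (k.+1%:R + (c + 1)) * B - y * C - k.+1%:R * B + y * B by rewrite h1; ring.
have h2' : y * D = (k.+1%:R + (c + 1 + 1)) * C - k.+1%:R * C -
    ((k.+1%:R + (c + 1)) * B - y * C) by rewrite -h2; ring.
by rewrite h1' h2' -[k.+2]addn1 natrD; ring.
Qed.

(** The usual derivative [- L_(k-1)^(c+1)] rewritten by contiguity, so that the degree index does
    not drop and [k = 0] fits the same formula. *)
Global Instance is_derive_lag k c y :
  is_derive y 1 (lag k c) (lag k c y - lag k (c + 1) y).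
Proof.
elim: k c => [|k IH] c /=; first by apply: is_derive_eq; rewrite subrr.
have ? := IH c; have ? := IH (c + 1).
by apply: is_derive_eq; rewrite /GRing.scale/=; ring.
Qed.

Lemma powRS p y : 0 < y -> y `^ (p + 1) = y * y `^ p.
Proof.
by move=> y0; rewrite powRD ?(gt_eqF y0) ?implybT// powRr1 ?ltW// mulrC.
Qed.

Lemma derive1n_expRN_powR k (p y : R) : 0 < y ->
  derive1n k (fun t => expR (- t) * t `^ p) y =
  expR (- y) * y `^ (p - k%:R) * lag k (p - k%:R) y.
Proof.
elim: k y => [|k IH] y y0; first by rewrite derive1n0 subr0 mulr1.
rewrite derive1nS derive1E.
set c := p - k.+1%:R.
have pE : p - k%:R = c + 1 by rewrite /c -natr1; ring.
rewrite pE in IH.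
(* The induction hypothesis holds for positive arguments only; these form a neighbourhood of [y],
   which suffices for a derivative. *)
rewrite (@near_eq_derive _ _ _ _
    (fun z => expR (- z) * z `^ (c + 1) * lag k (c + 1) z)); last first.
  by near=> z; apply: IH; near: z; exact: lt_nbhsr.
have ? := is_derive1_powR (c + 1) y0.
rewrite derive_val -lag_contiguous /= addrK /GRing.scale/=.
rewrite powRS//.
by ring.
Unshelve. all: end_near. Qed.

Lemma LaguerreE k c y : 0 < y -> Laguerre k c y = lag k c y / k`!%:R.
Proof.
move=> y0; rewrite /Laguerre derive1n_expRN_powR// (addrC _ c) addrK powRN.
have := expR_gt0 y; have := powR_gt0 c y0; rewrite expRN => p0 e0.
by field; rewrite ?gt_eqF ?ltr0n ?fact_gt0.
Qed.

(** Telescopes [lag_contiguous]. It trades the parameter [n/2] of the density for [n/2 - 1], the one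
    produced by differentiating Gaussians in [a]. *)
Lemma lag_sum k c y :
  lag k (c + 1) y / k`!%:R = \sum_(j < k.+1) lag j c y / j`!%:R.
Proof.
elim: k => [|k IH]; first by rewrite big_ord1.
rewrite big_ord_recr -IH -(lag_contiguous k c)/= factS natrM.
have : k`!%:R != 0 :> R by rewrite pnatr_eq0 -lt0n fact_gt0.
have : k.+1%:R != 0 :> R by rewrite pnatr_eq0.
by move=> ? ?; field; apply/andP.
Qed.

Lemma expRn_div_fact_le k (x : R) : 0 <= x -> x ^+ k / k`!%:R <= expR x.
Proof.
case: k => [|k] x0; first by rewrite expr0 fact0 divr1 -expR0 ler_expR.
by rewrite (le_trans _ (expR_ge1Dxn k x0))// lerDr.
Qed.

(** A polynomial of degree [k] is bounded by a multiple of [(1 + y)^k], hence of a growing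
    exponential. The rate [1/4] is a choice that leaves decay after multiplication by [exp(-y)]. *)
Lemma lag_bound k c : exists2 C : R, 0 < C &
  forall y, 0 <= y -> `|lag k c y| <= C * expR (y / 4).
Proof.
suff [C C0 HC] : exists2 C : R, 0 < C & forall y, 0 <= y -> `|lag k c y| <= C * (1 + y) ^+ k.
  exists (C * (4 ^+ k * k`!%:R * expR 4^-1)) => [|y y0].
    by rewrite !mulr_gt0 ?exprn_gt0 ?expR_gt0// ltr0n fact_gt0.
  rewrite (le_trans (HC y y0))// -mulrA ler_pM2l//.
  have -> : expR (y / 4) = expR ((1 + y) / 4) / expR 4^-1.
    by rewrite -expRN -expRD; congr expR; lra.
  have e0 := expR_gt0 (4^-1 : R).
  rewrite [leRHS](_ : _ = 4 ^+ k * k`!%:R * expR ((1 + y) / 4)); last first.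
    by field; rewrite gt_eqF.
  have y1 : 0 <= (1 + y) / 4 by rewrite divr_ge0 ?addr_ge0.
  have f0 : 0 < k`!%:R :> R by rewrite ltr0n fact_gt0.
  rewrite -[X in X <= _](_ : 4 ^+ k * k`!%:R * (((1 + y) / 4) ^+ k / k`!%:R) = _); last first.
    by rewrite expr_div_n; field; rewrite ?gt_eqF//.
  by rewrite ler_pM2l ?mulr_gt0 ?exprn_gt0// expRn_div_fact_le.
elim: k c => [|k IH] c; first by exists 1 => // y _; rewrite expr0 normr1 mulr1.
have [A A0 HA] := IH c; have [B B0 HB] := IH (c + 1).
exists (`|k.+1%:R + c| * A + B) => [|y y0 /=]; first by rewrite ltr_wpDl// mulr_ge0 // ltW.
rewrite (le_trans (ler_normB _ _))// !normrM (ger0_norm y0).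
have y1 : 0 <= 1 + y by rewrite addr_ge0.
have := HA _ y0; have := HB _ y0; set t := (1 + y) ^+ k; set u := `|_ + c|.
have u0 : 0 <= u := normr_ge0 _.
have t0 : 0 <= t by exact: exprn_ge0.
rewrite exprS -/t => hB hA.
have : y * `|lag k (c + 1) y| <= y * (B * t) by rewrite ler_wpM2l.
have : u * `|lag k c y| <= u * (A * t) by rewrite ler_wpM2l.
have : 0 <= u * (A * t) * y + B * t by rewrite addr_ge0 ?mulr_ge0// ltW.
by move=> *; nra.
Qed.

Lemma is_derive_divl r a : a != 0 -> is_derive a 1 (fun b => r / b) (- (r / a) / a).
Proof.
move=> a0; have ? : is_derive a 1 (fun b : R => b^-1) (- a ^- 2).
  have := is_deriveV (f := id) a0 (is_derive_id a (1 : R)).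
  by rewrite /GRing.scale/= mulr1.
by apply: is_derive_eq; rewrite /GRing.scale/=; field.
Qed.

Lemma is_derive_addl r a : is_derive a 1 (fun b : R => r + b) 1.
Proof.
by have := is_deriveD (is_derive_cst (r : R) a 1) (is_derive_id a 1); rewrite add0r.
Qed.

(* [(-1)^j] times the [j]-th derivative of [a^(-c-1) exp(-r/a)] in [a]. *)
Definition heat c j a r := 
  a `^ (- (c + j.+1%:R)) * lag j c (r / a) * expR (- (r / a)).

(** Differentiating the exponential cancels one of the two terms in the derivative of [lag]; the
    other one and the derivative of the power of [a] form the recursion defining [lag j.+1 c]. *)
Lemma is_derive_heat c j a r : 0 < a ->
  is_derive a 1 (heat c j ^~ r) (- heat c j.+1 a r).
Proof.
move=> a0; rewrite /heat.
have ? := is_derive1_powR (- (c + j.+1%:R)) a0.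
have ? : is_derive a 1 (fun b => r / b) (- (r / a) / a).
  by apply: is_derive_divl; rewrite gt_eqF.
have ? : is_derive a 1 (fun b => lag j c (r / b))
    ((lag j c (r / a) - lag j (c + 1) (r / a)) * (- (r / a) / a)).
  exact: is_derive1_comp.
apply: is_derive_eq.
rewrite /= /GRing.scale/=.
have -> : - (c + j.+1%:R) - 1 = - (c + j.+2%:R) by rewrite -[j.+2]addn1 natrD; ring.
have -> : - (c + j.+1%:R) = - (c + j.+2%:R) + 1.
  by rewrite -[j.+2]addn1 natrD; ring.
rewrite powRS//.
by rewrite /= ; field; rewrite gt_eqF.
Qed.

End laguerre.

(** * Integrals over tuples *)

Section tuple_integral.
Context {R : realType}.
Local Open Scope ereal_scope.

(** Tonelli after a change of variables. The measures are arbitrary; the successor case of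
    [lebesgue_tuple] is an instance by unfolding. *)
Lemma ge0_integral_pushforward_prod d1 d2 d3 (T1 : measurableType d1)
    (T2 : measurableType d2) (T3 : measurableType d3)
    (m1 : {sigma_finite_measure set T1 -> \bar R})
    (m2 : {sigma_finite_measure set T2 -> \bar R})
    (phi : T1 * T2 -> T3) (mphi : measurable_fun setT phi) (f : T3 -> \bar R) :
  measurable_fun setT f -> (forall y, 0 <= f y) ->
  \int[pushforward (m1 \x m2) phi]_y f y = \int[m1]_t \int[m2]_y f (phi (t, y)).
Proof.
move=> mf f0; rewrite (ge0_integral_pushforward mphi (m1 \x m2))// preimage_setT.
by rewrite fubini_tonelli1//=; exact: measurableT_comp.
Qed.

Lemma ge0_integral_lebesgue_tupleS n (f : n.+1.-tuple R -> \bar R) :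
  measurable_fun setT f -> (forall y, 0 <= f y) ->
  \int[lebesgue_tuple n.+1]_y f y =
  \int[(@lebesgue_measure R)]_t \int[lebesgue_tuple n]_y f (cons_pair (t, y)).
Proof.
move=> mf f0.
exact: (@ge0_integral_pushforward_prod _ _ _ _ _ _ (@lebesgue_measure R)
  (lebesgue_tuple n) _ (@measurable_cons_pair R n) f mf f0).
Qed.

Lemma measurable_prod_tnth n (g : 'I_n -> R -> R) :
  (forall i, measurable_fun setT (g i)) ->
  measurable_fun setT (fun y : n.-tuple R => \prod_(i < n) g i (tnth y i))%R.
Proof.
move=> mg; apply: measurable_prod => i _.
by apply: measurableT_comp => //; exact: measurable_tnth.
Qed.

(** Tonelli peels off one coordinate at a time, down to the unit mass on tuples of length 0. It
    serves for Gaussians, which factor over the coordinates. *)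
Lemma ge0_integral_prod_tuple n (g : 'I_n -> R -> R) (c : 'I_n -> R) :
  (forall i, measurable_fun setT (g i)) -> (forall i t, (0 <= g i t)%R) ->
  (forall i, \int[(@lebesgue_measure R)]_t (g i t)%:E = (c i)%:E) ->
  \int[lebesgue_tuple n]_y (\prod_(i < n) g i (tnth y i))%:E = (\prod_(i < n) c i)%:E.
Proof.
elim: n g c => [|n IH] g c mg g0 gc.
  rewrite /= integral_dirac// ?diracT ?mul1e ?big_ord0//.
  by apply/measurable_EFinP; exact: measurable_prod_tnth.
rewrite [LHS]ge0_integral_lebesgue_tupleS; last 2 first.
- by apply/measurable_EFinP; exact: measurable_prod_tnth.
- by move=> y; rewrite lee_fin prodr_ge0.
transitivity (\int[(@lebesgue_measure R)]_t
    ((g ord0 t)%:E * (\prod_(i < n) c (lift ord0 i))%:E)).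
  apply: eq_integral => t _.
  rewrite -(IH (fun i => g (lift ord0 i)))//.
  rewrite -ge0_integralZl//.
  - apply: eq_integral => y _; rewrite -EFinM big_ord_recl; congr (_ * _)%:E.
    by apply: eq_bigr => i _; congr (g _ _); exact: tnthS.
  - apply/measurable_EFinP.
    by apply: (@measurable_prod_tnth n (fun i => g (lift ord0 i))) => i; exact: mg.
  - by move=> y _; rewrite lee_fin prodr_ge0.
  - by rewrite lee_fin.
rewrite ge0_integralZr//.
- by rewrite gc big_ord_recl EFinM.
- by apply/measurable_EFinP; exact: mg.
- by move=> t _; rewrite lee_fin.
- rewrite lee_fin prodr_ge0// => i _; rewrite -lee_fin -gc.
  by apply: integral_ge0 => t _; rewrite lee_fin.
Qed.

(** * Points as null sets *)

Lemma measurable_tuple1 n (x : n.-tuple R) : measurable [set x].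
Proof.
rewrite (_ : [set x] = \bigcap_(i in [set: 'I_n]) ((@tnth n R)^~ i @^-1` [set tnth x i])).
  apply: fin_bigcap_measurable => // i _.
  by rewrite -[X in measurable X]setTI; exact: measurable_tnth.
apply/seteqP; split => [y -> //|y yx].
by apply/eq_from_tnth => i; exact: yx.
Qed.

Lemma lebesgue_tuple1 n (x : n.+1.-tuple R) : lebesgue_tuple n.+1 [set x] = 0.
Proof.
rewrite /= /lebesgue_cons /pushforward.
rewrite (_ : _ @^-1` _ = [set thead x] `*` [set [tuple of behead x]]); last first.
  apply/seteqP; split => [[t y] /= <-|[t y] /= [-> ->]].
    by split => //; apply/val_inj.
  by rewrite [RHS]tuple_eta; apply/val_inj.
rewrite product_measure1E//; last exact: measurable_tuple1.
by rewrite [X in X * _](lebesgue_measure_set1 (thead x)) mul0e.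
Qed.

Lemma lebesgue_tuple_set1 n (p : n.-tuple R) : (0 < n)%N ->
  lebesgue_tuple n [set p] = 0.
Proof. by case: n p => // n p _; exact: lebesgue_tuple1. Qed.

(** For use at two points: the origin, where the Rodrigues formula gives a junk value, and [x],
    where the kernel may be singular. *)
Lemma ae_eq_off_point n (p : n.-tuple R) (A B : n.-tuple R -> \bar R) :
  (0 < n)%N -> (forall y, y <> p -> A y = B y) ->
  ae_eq (lebesgue_tuple n : {measure set (n.-tuple R) -> \bar R}) setT A B.
Proof.
move=> n0 h; exists [set p]; split.
- exact: measurable_tuple1.
- exact: lebesgue_tuple_set1.
- move=> y /= /not_implyP[_ hy]; apply: contrapT => yp; exact/hy/h.
Qed.

Lemma integrable_off_point n (p : n.-tuple R) (A B : n.-tuple R -> \bar R) :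
  (0 < n)%N -> measurable_fun setT B -> (forall y, y <> p -> A y = B y) ->
  (lebesgue_tuple n).-integrable setT A -> (lebesgue_tuple n).-integrable setT B.
Proof.
move=> n0 mB AB /integrableP[mA]; move=> h; apply/integrableP; split => //.
apply: le_lt_trans h; rewrite le_eqVlt; apply/predU1P; left; apply: ae_eq_integral => //.
- exact: measurableT_comp.
- exact: measurableT_comp.
- by apply: (ae_eq_off_point n p _ _ n0) => y yp /=; rewrite AB.
Qed.

Lemma Rintegral_off_point n (p : n.-tuple R) (A B : n.-tuple R -> R) :
  (0 < n)%N -> measurable_fun setT A -> measurable_fun setT B ->
  (forall y, y <> p -> A y = B y) ->
  (\int[lebesgue_tuple n]_y A y = \int[lebesgue_tuple n]_y B y)%R.
Proof.
move=> n0 mA mB AB; congr fine; apply: ae_eq_integral => //.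
- exact/measurable_EFinP.
- exact/measurable_EFinP.
- by apply: (ae_eq_off_point n p _ _ n0) => y yp /=; rewrite AB.
Qed.

(** * Gaussian integrals *)

Lemma integral_gauss1 (a m : R) : (0 < a)%R ->
  \int[(@lebesgue_measure R)]_t (expR (- ((t - m) ^+ 2 / a)))%:E = (Num.sqrt (pi * a))%:E.
Proof.
move=> a0.
(* Up to a factor, the integrand is the normal density with mean [m] and variance [a / 2], whose
   integral is 1. *)
have s0 : Num.sqrt (a / 2) != 0%R by rewrite gt_eqF// sqrtr_gt0 divr_gt0.
have := @integral_normal_pdf R m (Num.sqrt (a / 2)).
have pdfE t : normal_pdf m (Num.sqrt (a / 2)) t =
    ((Num.sqrt (pi * a))^-1 * expR (- (t - m) ^+ 2 / a))%R.
  rewrite /normal_pdf (negbTE s0) /normal_peak /normal_fun /=.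
  rewrite sqr_sqrtr ?divr_ge0 ?ltW//; congr (_^-1 * expR _)%R.
    by congr Num.sqrt; rewrite -mulr_natr; field.
  by rewrite -mulr_natr divfK.
under eq_integral do rewrite pdfE EFinM.
have mg : measurable_fun setT (fun t : R => expR (- (t - m) ^+ 2 / a)).
  apply: measurableT_comp => //.
  apply: measurable_funM => //; apply: measurableT_comp => //.
  by apply: measurable_funX; apply: measurable_funB.
rewrite ge0_integralZl//; last exact/measurable_EFinP.
under [X in _ -> X = _]eq_integral do rewrite -mulNr.
set I := integral _ _ _ => h.
have spa : (0 < Num.sqrt (pi * a))%R by rewrite sqrtr_gt0 mulr_gt0 ?pi_gt0.
rewrite -[LHS]mul1e -[in LHS](divff (lt0r_neq0 spa)) EFinM -muleA.
by rewrite [X in _ * X](_ : _ = 1) ?mule1.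
Qed.

(** Completing the square in [t]: a Gaussian centred at [a xi / (a + b)] of width parameter
    [a b / (a + b)] splits off, and [xi^2 / (a + b)] remains. *)
Lemma integral_gauss2 (a b xi : R) : (0 < a)%R -> (0 < b)%R ->
  \int[(@lebesgue_measure R)]_t (expR (- (t ^+ 2 / a)) * expR (- ((xi - t) ^+ 2 / b)))%:E =
  (Num.sqrt (pi * (a * b / (a + b))) * expR (- (xi ^+ 2 / (a + b))))%:E.
Proof.
move=> a0 b0; have ab0 := addr_gt0 a0 b0.
have h0 : (0 < a * b / (a + b))%R by rewrite divr_gt0 ?mulr_gt0.
rewrite mulrC EFinM -(@integral_gauss1 _ (a * xi / (a + b))%R)// -ge0_integralZl//.
  apply: eq_integral => t _; rewrite -EFinM -!expRD; congr (expR _)%:E.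
  by field; rewrite ?(gt_eqF a0) ?(gt_eqF b0) ?(gt_eqF ab0).
apply/measurable_EFinP; apply: measurableT_comp => //.
apply: measurableT_comp => //; apply: measurable_funM => //.
by apply: measurable_funX; apply: measurable_funB.
Qed.

Lemma enorm_sqr n (y : n.-tuple R) : (enorm y ^+ 2 = \sum_(i < n) tnth y i ^+ 2)%R.
Proof. by rewrite sqr_sqrtr// sumr_ge0// => i _; exact: sqr_ge0. Qed.

Lemma edist_sqr n (x y : n.-tuple R) :
  (edist x y ^+ 2 = \sum_(i < n) (tnth x i - tnth y i) ^+ 2)%R.
Proof. by rewrite sqr_sqrtr// sumr_ge0// => i _; exact: sqr_ge0. Qed.

Lemma sqrt_exp_powR n (z : R) : (0 <= z)%R -> (Num.sqrt z ^+ n = z `^ (n%:R / 2))%R.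
Proof.
by move=> z0; rewrite -powR12_sqrt// -powR_mulrn ?powR_ge0// -powRrM mulrC.
Qed.

Lemma integral_gauss_tuple n (a : R) : (0 < a)%R ->
  \int[lebesgue_tuple n]_y (expR (- (enorm y ^+ 2 / a)))%:E =
  ((pi * a) `^ (n%:R / 2))%:E.
Proof.
move=> a0; rewrite -sqrt_exp_powR ?mulr_ge0 ?pi_ge0 ?ltW//.
have := @ge0_integral_prod_tuple n (fun _ t => expR (- ((t - 0) ^+ 2 / a)))
  (fun=> Num.sqrt (pi * a)).
rewrite prodr_const card_ord => <-//.
- apply: eq_integral => y _; rewrite -expR_sum enorm_sqr mulr_suml -sumrN.
  by congr (expR _)%:E; apply: eq_bigr => i _; rewrite subr0.
- move=> _; apply: measurableT_comp => //.
  apply: measurableT_comp => //; apply: measurable_funM => //.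
  by apply: measurable_funX; apply: measurable_funB.
- by move=> _; rewrite integral_gauss1.
Qed.

(** [integral_gauss2] in each coordinate. Normalized by [a^(-n/2) b^(-n/2)], it says that widths add
    under convolution. *)
Lemma integral_gauss_conv_tuple n (a b : R) (x : n.-tuple R) : (0 < a)%R -> (0 < b)%R ->
  \int[lebesgue_tuple n]_y (expR (- (enorm y ^+ 2 / a)) * expR (- (edist x y ^+ 2 / b)))%:E =
  ((pi * (a * b / (a + b))) `^ (n%:R / 2) * expR (- (enorm x ^+ 2 / (a + b))))%:E.
Proof.
move=> a0 b0; have ab0 := addr_gt0 a0 b0.
have h0 : (0 < a * b / (a + b))%R by rewrite divr_gt0 ?mulr_gt0.
rewrite -sqrt_exp_powR; last by rewrite mulr_ge0 ?pi_ge0// ltW.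
have := @ge0_integral_prod_tuple n
  (fun i t => expR (- (t ^+ 2 / a)) * expR (- ((tnth x i - t) ^+ 2 / b)))%R
  (fun i => Num.sqrt (pi * (a * b / (a + b))) * expR (- (tnth x i ^+ 2 / (a + b))))%R.
rewrite big_split/= prodr_const card_ord -expR_sum enorm_sqr mulr_suml -sumrN => <-//.
- apply: eq_integral => y _; rewrite big_split/= -!expR_sum enorm_sqr edist_sqr.
  by rewrite !mulr_suml -!sumrN.
- move=> i; apply: measurable_funM; apply: measurableT_comp => //;
   apply: measurableT_comp => //; apply: measurable_funM => //;
   by apply: measurable_funX => //; apply: measurable_funB.
- by move=> i; exact: integral_gauss2.
Qed.

End tuple_integral.

(** * The half-line and the Gamma function *)

Section halfline.
Context {R : realType}.
Local Notation mu := (@lebesgue_measure R).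
Implicit Types (f F : R -> R) (c : R).

(** Compact intervals exhausting the open half-line; on each of them the behaviour of a primitive at
    0 and at infinity does not intervene. *)
Let J (k : nat) : set R := `[k.+2%:R^-1, k.+2%:R].

Let JE : \bigcup_k J k = `]0, +oo[%classic.
Proof.
apply/seteqP; split => [t [k _]|t]; rewrite /J /= !in_itv/=.
  by move=> /andP[h _]; rewrite andbT (lt_le_trans _ h)// invr_gt0.
rewrite andbT => t0.
have [k hk] : exists k : nat, Num.max t t^-1 <= k%:R.
  exists (Num.truncn (Num.max t t^-1)).+1; rewrite ltW//.
  by apply: truncnS_gt.
exists k => //=; rewrite in_itv/=.
have hk2 : Num.max t t^-1 <= k.+2%:R by rewrite (le_trans hk)// ler_nat -addn2 leq_addr.
move: hk2; rewrite ge_max => /andP[-> h]; rewrite andbT.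
by rewrite -[leRHS]invrK lef_pV2 ?posrE// invr_gt0.
Qed.

Let mJ k : measurable (J k). Proof. exact: measurable_itv. Qed.

Let ndJ : nondecreasing_seq J.
Proof.
move=> m n mn; rewrite subsetEset => t; rewrite /J /= !in_itv/= => /andP[h1 h2].
apply/andP; split; last by rewrite (le_trans h2)// ler_nat ltnS.
by rewrite (le_trans _ h1)// lef_pV2 ?posrE// ler_nat ltnS.
Qed.

Let JD k : J k `<=` `]0, +oo[. Proof. by rewrite -JE; exact: bigcup_sup. Qed.

Let ge0_cvg_J (f : R -> \bar R) :
  measurable_fun (`]0%R, +oo[%classic : set R) f -> (forall x : R, (0 < x)%R -> (0 <= f x)%E) ->
  (\int[mu]_(x in J k) f x @[k --> \oo] --> \int[mu]_(x in `]0%R, +oo[) f x)%E.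
Proof.
move=> mf f0; rewrite -JE; apply: ge0_nondecreasing_set_cvg_integral => //.
- by move=> k; apply: measurable_funS mf => //; exact: JD.
- by move=> k x /JD; rewrite /= in_itv/= andbT; exact: f0.
Qed.

Let cvg_J (f : R -> \bar R) : mu.-integrable (`]0%R, +oo[%classic : set R) f ->
  (\int[mu]_(x in J k) f x @[k --> \oo] --> \int[mu]_(x in `]0%R, +oo[) f x)%E.
Proof.
move=> fi; have mf := measurable_int mu fi.
rewrite integralE; under eq_fun do rewrite integralE.
apply: cvgeB.
- by apply: fin_num_adde_defl; rewrite fin_numN; exact: integrable_neg_fin_num.
- by apply: ge0_cvg_J => //; exact: measurable_funepos.
- by apply: ge0_cvg_J => //; exact: measurable_funeneg.
Qed.

Lemma FTC_cc (f F : R -> R) (p q : R) : 0 < p -> p <= q ->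
  (forall x : R, 0 < x -> is_derive x 1 F (f x)) ->
  (forall x : R, 0 < x -> {for x, continuous f}) ->
  (\int[mu]_(x in `[p, q]) (f x)%:E = (F q - F p)%:E)%E.
Proof.
move=> p0; rewrite le_eqVlt => /predU1P[<- _ _|pq dF cf].
  by rewrite subrr set_itv1 integral_set1.
have cF (x : R) : 0 < x -> {for x, continuous F}.
  by move=> /dF[? _]; exact/differentiable_continuous/derivable1_diffP.
rewrite EFinB (@continuous_FTC2 _ f F)//.
- apply: continuous_in_subspaceT => x.
  rewrite inE/= in_itv/= => /andP[h _]; apply: cf; exact: lt_le_trans h.
- split.
  + by move=> x; rewrite in_itv/= => /andP[h _]; case: (dF _ (lt_trans p0 h)).
  + by apply: cvg_at_right_filter; exact: cF.
  + by apply: cvg_at_left_filter; apply: cF; exact: lt_trans pq.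
- move=> x; rewrite in_itv/= => /andP[h _].
  by rewrite derive1E; case: (dF _ (lt_trans p0 h)).
Qed.

(** * Improper integrals from primitives *)

Section ftc.
Variables (f F : R -> R) (A B : R).
Hypothesis dF : forall x : R, 0 < x -> is_derive x 1 F (f x).
Hypothesis cf : forall x : R, 0 < x -> {for x, continuous f}.
Hypothesis FA : F k.+2%:R^-1 @[k --> \oo] --> A.
Hypothesis FB : F k.+2%:R @[k --> \oo] --> B.

Lemma measurable_fun_itv0y : measurable_fun (`]0%R, +oo[%classic : set R) f.
Proof.
apply: open_continuous_measurable_fun; first exact: interval_open.
by move=> x; rewrite inE/= in_itv/= andbT; exact: cf.
Qed.

Let FTC_J k : (\int[mu]_(x in J k) (f x)%:E = (F k.+2%:R - F k.+2%:R^-1)%:E)%E.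
Proof.
have k0 : 0 < k.+2%:R^-1 :> R by rewrite invr_gt0.
apply: (FTC_cc f F _ _ k0) => //.
by rewrite (@le_trans _ _ 1)// ?invf_le1 ?ler1n.
Qed.

Let cvgF : ((F k.+2%:R - F k.+2%:R^-1)%:E @[k --> \oo] --> (B - A)%:E)%E.
Proof. by apply: cvg_EFin; [exact: nearW|apply: cvgB]. Qed.

(** Monotone convergence along [J] applies without prior integrability, which can then be read off
    from the finite value. *)
Lemma ge0_FTC_itv0y : (forall x : R, 0 < x -> 0 <= f x) ->
  (\int[mu]_(x in `]0%R, +oo[) (f x)%:E = (B - A)%:E)%E.
Proof.
move=> f0; have mf : measurable_fun (`]0%R, +oo[%classic : set R) (EFin \o f).
  by apply/measurable_EFinP; exact: measurable_fun_itv0y.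
have := ge0_cvg_J _ mf f0.
by under eq_fun do rewrite FTC_J; move=> h; exact: cvg_unique h cvgF.
Qed.

(** For a signed integrand the limits of [F] alone would allow conditional convergence, hence the
    integrability hypothesis. *)
Lemma integrable_FTC_itv0y : mu.-integrable (`]0%R, +oo[%classic : set R) (EFin \o f) ->
  (\int[mu]_(x in `]0%R, +oo[) (f x)%:E = (B - A)%:E)%E.
Proof.
move=> /cvg_J.
by under eq_fun do rewrite FTC_J; move=> h; exact: cvg_unique h cvgF.
Qed.

End ftc.

Lemma cvg_invn2 : (k.+2%:R^-1 : R) @[k --> \oo] --> (0 : R).
Proof.
have : (n.+1%:R^-1 : R) @[n --> \oo] --> (0 : R) by exact: cvg_harmonic.
by rewrite -cvg_shiftS.
Qed.

Lemma powR_cvg_invn2 c : 0 < c -> (k.+2%:R^-1 : R) `^ c @[k --> \oo] --> (0 : R).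
Proof.
move=> c0; have /cvg_at_rightP := powR_cvg0 c0; apply; split.
  by move=> k; rewrite invr_gt0.
exact: cvg_invn2.
Qed.

Lemma continuous_powR c (x : R) : 0 < x -> {for x, continuous (@powR R ^~ c)}.
Proof.
move=> /(is_derive1_powR c) [d _]; exact/differentiable_continuous/derivable1_diffP.
Qed.

Lemma powR_le_expR c : exists2 C : R, 0 < C & forall t : R, 1 <= t -> t `^ c <= C * expR t.
Proof.
(* A natural number above [c]; for negative [c] the truncation is 0 and [m = 1]. *)
pose m := (Num.truncn c).+1.
have f0 : 0 < m`!%:R :> R by rewrite ltr0n fact_gt0.
exists m`!%:R => // t t1; have t0 : 0 <= t by rewrite (le_trans _ t1).
apply: (@le_trans _ _ (t ^+ m)).
  by rewrite -powR_mulrn// ler_powR// ltW// truncnS_gt.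
by rewrite mulrC -ler_pdivrMr// expRn_div_fact_le.
Qed.

(** One spare power: [t^(c+1) <= C exp(t)] bounds the sequence by [C / t]. *)
Lemma cvg_powR_expRN c : (k.+2%:R `^ c * expR (- k.+2%:R) : R) @[k --> \oo] --> (0 : R).
Proof.
have [C C0 HC] := powR_le_expR (c + 1).
apply: (@squeeze_cvgr _ _ _ _ (fun=> 0) (fun k => C * k.+2%:R^-1)).
- apply: nearW => k; rewrite mulr_ge0 ?powR_ge0 ?expR_ge0//=.
  have k1 : 1 <= k.+2%:R :> R by rewrite ler1n.
  have := HC _ k1; rewrite powRS// expRN ler_pdivrMr ?expR_gt0// => h.
  by rewrite mulrAC ler_pdivlMr// mulrC.
- exact: cvg_cst.
- rewrite -(mulr0 C); apply: cvgM; [exact: cvg_cst|exact: cvg_invn2].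
Qed.

(** * The complete and the incomplete Gamma function *)

Definition gammaf c t := t `^ (c - 1) * expR (- t).

Lemma gammaf_ge0 c t : 0 <= gammaf c t.
Proof. by rewrite mulr_ge0 ?powR_ge0 ?expR_ge0. Qed.

Lemma continuous_gammaf c (x : R) : 0 < x -> {for x, continuous (gammaf c)}.
Proof.
move=> x0; apply: cvgM; first exact: continuous_powR.
apply: (@continuous_comp _ _ _ -%R expR); first exact: opp_continuous.
exact: continuous_expR.
Qed.

Lemma measurable_gammaf c : measurable_fun setT (gammaf c).
Proof.
apply: measurable_funM; first exact: measurable_powR.
by apply: measurableT_comp => //; apply: measurableT_comp.
Qed.

(* Dominates by [t^(c-1)/(1+t)^(c+1)], the derivative of [(t/(1+t))^c / c]. *)
Lemma integrable_gammaf c : 0 < c ->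
  mu.-integrable (`]0%R, +oo[%classic : set R) (EFin \o gammaf c).
Proof.
move=> c0.
pose G t : R := t `^ (c - 1) * (1 + t) `^ (- c - 1).
have G0 t : 0 <= G t by rewrite mulr_ge0 ?powR_ge0.
have IG : (\int[mu]_(x in `]0%R, +oo[) (G x)%:E = (c^-1 - 0)%:E)%E.
  apply: (@ge0_FTC_itv0y G (fun t => c^-1 * (t / (1 + t)) `^ c)) => //.
  - move=> t t0; have t1 : 0 < 1 + t by rewrite addr_gt0.
    have w0 : 0 < t / (1 + t) by rewrite divr_gt0.
    have ? : is_derive t 1 (fun t : R => (1 + t)^-1) (- (1 + t) ^- 2).
      have h := is_derive_addl 1 t.
      by have := is_deriveV (f := fun t => 1 + t) (lt0r_neq0 t1) h; rewrite /GRing.scale/= mulr1.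
    have ? : is_derive t 1 (fun t : R => t / (1 + t)) ((1 + t) ^- 2).
      by apply: is_derive_eq; rewrite /GRing.scale/=; field; rewrite gt_eqF.
    have ? := is_derive1_powR c w0.
    have ? : is_derive t 1 (fun t : R => (t / (1 + t)) `^ c)
      (c * (t / (1 + t)) `^ (c - 1) * (1 + t) ^- 2).
      exact: (@is_derive1_comp R (@powR R ^~ c) (fun t => t / (1 + t))).
    apply: is_derive_eq; rewrite /GRing.scale/= /G.
    have -> : (1 + t) `^ (- c - 1) = ((1 + t) `^ (c - 1))^-1 * (1 + t) ^- 2.
      rewrite -powRN -powR_invn ?(ltW t1)// -powRD ?(gt_eqF t1) ?implybT//.
      by congr (_ `^ _); ring.
    have -> : (t / (1 + t)) `^ (c - 1) = t `^ (c - 1) / (1 + t) `^ (c - 1).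
      rewrite powRM ?invr_ge0 ?ltW//; congr (_ * _).
      by rewrite -powR_inv1 ?(ltW t1)// -powRrM mulN1r powRN.
    by field; rewrite !gt_eqF ?powR_gt0.
  - move=> t t0; apply: cvgM; first exact: continuous_powR.
    have t1 : 0 < 1 + t by rewrite addr_gt0.
    have h : 1 + x @[x --> t] --> 1 + t by apply: cvgD; [exact: cvg_cst|exact: cvg_id].
    exact: (cvg_comp _ _ h (continuous_powR (- c - 1) _ t1)).
  - rewrite -(mulr0 c^-1); apply: cvgM; first exact: cvg_cst.
    have e (k : nat) : k.+2%:R^-1 / (1 + k.+2%:R^-1) = k.+3%:R^-1 :> R.
      rewrite -(@nat1r R k.+2); have : 0 < k.+2%:R :> R by [].
      move: (k.+2%:R : R) => z z0; have z1 : 0 < 1 + z by rewrite addr_gt0.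
      by field; rewrite ?(addrC z) ?(gt_eqF z0) ?(gt_eqF z1).
    under eq_fun do rewrite e.
    by have := powR_cvg_invn2 _ c0; rewrite -cvg_shiftS.
  - rewrite -[X in _ --> X]mulr1; apply: cvgM; first exact: cvg_cst.
    have e (k : nat) : k.+2%:R / (1 + k.+2%:R) = 1 - k.+3%:R^-1 :> R.
      rewrite -(@nat1r R k.+2); have : 0 < k.+2%:R :> R by [].
      move: (k.+2%:R : R) => z z0; have z1 : 0 < 1 + z by rewrite addr_gt0.
      by field; rewrite ?(addrC z) ?(gt_eqF z0) ?(gt_eqF z1).
    have h : (1 - k.+3%:R^-1 : R) @[k --> \oo] --> (1 : R).
      rewrite -[X in _ --> X]subr0; apply: cvgB; first exact: cvg_cst.
      by have := cvg_invn2; rewrite -cvg_shiftS.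
    under eq_fun do rewrite e.
    have h1 : y `^ c @[y --> (1 : R)] --> (1 : R).
      by have := continuous_powR c _ (@ltr01 R); rewrite /prop_for /continuous_at /= powR1.
    exact: (cvg_comp _ _ h h1).
have mG : measurable_fun setT G.
  apply: measurable_funM; first exact: measurable_powR.
  have m1 : measurable_fun setT (fun t : R => 1 + t) by exact: measurable_funD.
  exact: (measurableT_comp (@measurable_powR R (- c - 1)) m1).
have [C C0 HC] : exists2 C : R, 0 < C & forall t, 0 < t -> gammaf c t <= C * G t.
  (* This bound requires an argument at least 1 and is taken at [1 + t]; [exp(1 + t)] accounts for
     the factor [expR 1]. *)
  have [C C0 HC] := powR_le_expR (c + 1).
  exists (C * expR 1); first by rewrite mulr_gt0 ?expR_gt0.
  move=> t t0; have t1 : 0 < 1 + t by rewrite addr_gt0.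
  have /HC h : 1 <= 1 + t by rewrite lerDl ltW.
  rewrite /gammaf /G mulrCA ler_wpM2l ?powR_ge0//.
  have -> : - c - 1 = - (c + 1) by ring.
  rewrite powRN ler_pdivlMr ?powR_gt0// expRN mulrC ler_pdivrMr ?expR_gt0//.
  by rewrite -mulrA -expRD.
have iG : mu.-integrable (`]0%R, +oo[%classic : set R) (EFin \o G).
  apply/integrableP; split; first by apply/measurable_EFinP; apply: measurable_funTS.
  by under eq_integral do rewrite gee0_abs ?lee_fin//; rewrite IG ltry.
have iCG : mu.-integrable (`]0%R, +oo[%classic : set R) (fun t => C%:E * (G t)%:E)%E.
  exact: integrableZl.
apply: (le_integrable _ _ _ iCG) => //.
- by apply/measurable_EFinP; apply: measurable_funTS; exact: measurable_gammaf.
- move=> t; rewrite /= in_itv/= andbT => t0.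
  rewrite lee_fin ger0_norm ?gammaf_ge0// (@ger0_norm _ (C * G t)).
    exact: HC.
  by rewrite mulr_ge0 ?G0 ?(ltW C0).
Qed.

(** Integration by parts: [t^c exp(-t)] vanishes at both ends, and its derivative is the difference
    of the two integrands. *)
Lemma GammaS c : 0 < c -> Gamma (c + 1) = c * Gamma c.
Proof.
move=> c0; have c10 : 0 < c + 1 by rewrite addr_gt0.
have i1 := integrable_gammaf _ c0; have i2 := integrable_gammaf _ c10.
have i3 : mu.-integrable (`]0%R, +oo[%classic : set R) (EFin \o (fun t => c * gammaf c t)).
  have h : mu.-integrable (`]0%R, +oo[%classic : set R) (fun t => c%:E * (gammaf c t)%:E)%E.
    exact: integrableZl.
  exact: h.
have i4 : mu.-integrable (`]0%R, +oo[%classic : set R)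
    (EFin \o (fun t => c * gammaf c t - gammaf (c + 1) t)).
  have h : mu.-integrable (`]0%R, +oo[%classic : set R)
      (fun t => (c * gammaf c t)%:E - (gammaf (c + 1) t)%:E)%E.
    exact: integrableB.
  exact: h.
have := @integrable_FTC_itv0y (fun t => c * gammaf c t - gammaf (c + 1) t)
  (fun t => t `^ c * expR (- t)) 0 0.
move=> /(_ _ _ _ _ i4) H.
have : \int[mu]_(t in `]0, +oo[) (c * gammaf c t - gammaf (c + 1) t) = 0.
  rewrite /Rintegral [X in fine X]H ?subrr//.
  - move=> t t0; have ? := is_derive1_powR c t0.
    by apply: is_derive_eq; rewrite /GRing.scale/= /gammaf addrK; ring.
  - move=> t t0; apply: cvgB; last exact: continuous_gammaf.
    by apply: cvgM; [exact: cvg_cst|exact: continuous_gammaf].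
  - rewrite -(mul0r (expR (- 0))); apply: cvgM; first exact: powR_cvg_invn2.
    exact: (cvg_comp _ _ (cvgN cvg_invn2) (@continuous_expR R _)).
  - exact: cvg_powR_expRN.
rewrite RintegralB// RintegralZl// => /eqP; rewrite subr_eq0 => /eqP/esym; exact.
Qed.

Lemma Gamma1 : Gamma (1 : R) = 1.
Proof.
suff H : (\int[mu]_(t in `]0%R, +oo[) (gammaf 1 t)%:E = (0 - -1)%:E)%E.
  by rewrite /Gamma /Rintegral [X in fine X]H opprK add0r.
apply: (@ge0_FTC_itv0y (gammaf 1) (fun t => - expR (- t)) (-1) 0).
- move=> t t0; apply: is_derive_eq; rewrite /GRing.scale/= /gammaf subrr powRr0; ring.
- by move=> t t0; exact: continuous_gammaf.
- apply: cvgN; rewrite -[X in _ --> X]expR0 -oppr0.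
  exact: (cvg_comp _ _ (cvgN cvg_invn2) (@continuous_expR R _)).
- rewrite -oppr0; apply: cvgN.
  by have := cvg_powR_expRN 0; under eq_fun do rewrite powRr0 mul1r.
- by move=> t _; exact: gammaf_ge0.
Qed.

Lemma lower_gammaE c x :
  0 < c -> lower_gamma c x = \int[mu]_(t in `]0, x]) gammaf c t.
Proof.
move=> c0; apply: Rintegral_itv_bndo_bndc.
apply: (integrableS _ _ _ (integrable_gammaf _ c0)) => // t.
by rewrite /= !in_itv/= andbT => /andP[].
Qed.

Lemma is_derive_lower_gamma c (x : R) : 0 < c -> 0 < x ->
  is_derive x 1 (lower_gamma c) (gammaf c x).
Proof.
move=> c0 x0.
have -> : lower_gamma c = fun y => \int[mu]_(t in `]0, y]) gammaf c t.
  by apply/funext => y; exact: lower_gammaE.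
(* Any end point beyond [x] would do. Integrability up to there and continuity at [x] suffice, so a
   singularity at 0 is harmless. *)
have x1 : x < x + 1 by rewrite ltrDl.
have i : mu.-integrable [set` Interval (BRight 0) (BRight (x + 1))] (EFin \o gammaf c).
  apply: (integrableS _ _ _ (integrable_gammaf _ c0)) => // t.
  by rewrite /= !in_itv/= andbT => /andP[].
have bx : (BRight 0 < BRight x)%O by rewrite lteBSide.
have [d e] := continuous_FTC1 x1 i bx (continuous_gammaf _ _ x0).
by split => //; rewrite -derive1E.
Qed.

Lemma lower_gamma_cvg0 c : 0 < c -> lower_gamma c x @[x --> 0] --> (0 : R).
Proof.
move=> c0.
(* [parameterized_integral] runs over a closed interval, so the integrand is cut off at 0 to match
   []0, x]]. *)
have := @parameterized_integral_cvg_left R 0 1 (gammaf c \_ `]0, +oo[) ltr01.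
have -> : (fun x => parameterized_integral mu 0 x (gammaf c \_ `]0, +oo[)) = lower_gamma c.
  apply/funext => x; rewrite lower_gammaE// /parameterized_integral -Rintegral_mkcondr.
  congr Rintegral; apply/seteqP; split => t; rewrite /= !in_itv/= ?andbT.
    by case=> /andP[_ ->] ->.
  by move=> /andP[h ->]; rewrite ltW.
apply; rewrite -restrict_EFin; apply/integrable_restrict => //.
by apply: (integrableS _ _ _ (integrable_gammaf _ c0)) => //; exact: measurableI.
Qed.

(** Monotone convergence. The scale [s] is there for [lower_gamma c (r / b)] with [b] tending to 0
    along [1 / (k + 2)]. *)
Lemma lower_gamma_cvgy c (s : R) : 0 < c -> 0 < s ->
  lower_gamma c (s * k.+2%:R) @[k --> \oo] --> Gamma c.
Proof.
move=> c0 s0; apply: fine_cvg; rewrite fineK; last first.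
  by apply: integrable_fin_num => //; exact: integrable_gammaf.
have DE : \bigcup_k `]0, (s * k.+2%:R)[%classic = `]0, +oo[%classic.
  apply/seteqP; split => [t [k _]|t]; rewrite /= !in_itv/= ?andbT; first by case/andP.
  move=> t0; exists (Num.truncn (t / s)).+1 => //=.
  rewrite in_itv/= t0/= mulrC -ltr_pdivrMr// (lt_le_trans (truncnS_gt _))// ler_nat.
  by rewrite -addn2 leq_addr.
rewrite -DE; apply: ge0_nondecreasing_set_cvg_integral.
- move=> m n mn; rewrite subsetEset => t; rewrite /= !in_itv/= => /andP[-> h]/=.
  by rewrite (lt_le_trans h)// ler_pM2l// ler_nat ltnS.
- by move=> k; exact: measurable_itv.
- by move=> k; apply/measurable_EFinP; apply: measurable_funTS; exact: measurable_gammaf.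
- by move=> k t _; rewrite lee_fin gammaf_ge0.
Qed.

End halfline.

(** * The kernel as a superposition of Gaussians *)

Section kernel.
Context {R : realType}.
Local Notation mu := (@lebesgue_measure R).
Local Notation D := (`]0%R, +oo[%classic : set R).
Implicit Types (c r a b : R).

(** Writing [1/x] as [x (x^2)^(-1)] reduces to real powers of nonnegative numbers; at 0 both sides
    are 0 by convention. *)
Lemma measurable_inv : measurable_fun setT (@GRing.inv R).
Proof.
have -> : @GRing.inv R = fun x => x * (x ^+ 2) `^ (-1).
  apply/funext => x; rewrite powR_inv1 ?sqr_ge0//.
  by have [->|x0] := eqVneq x 0; [rewrite mul0r invr0|field].
apply: measurable_funM => //.
exact: (measurableT_comp (@measurable_powR R (-1)) (measurable_funX _ (@measurable_id _ _ _))).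
Qed.

Lemma measurable_lag j c : measurable_fun setT (lag j c).
Proof.
elim: j c => [|j IH] c /=; first exact: measurable_cst.
by apply: measurable_funB; apply: measurable_funM.
Qed.

Lemma measurable_funV d (T : measurableType d) (f : T -> R) :
  measurable_fun setT f -> measurable_fun setT (fun x => (f x)^-1).
Proof. by move=> mf; exact: (measurableT_comp measurable_inv mf). Qed.

Lemma measurable_fun_powR d (T : measurableType d) (f : T -> R) p :
  measurable_fun setT f -> measurable_fun setT (fun x => f x `^ p).
Proof. by move=> mf; exact: (measurableT_comp (@measurable_powR R p) mf). Qed.

Lemma measurable_fun_expRN d (T : measurableType d) (f : T -> R) :
  measurable_fun setT f -> measurable_fun setT (fun x => expR (- f x)).
Proof. by move=> mf; apply: measurableT_comp => //; exact: measurableT_comp. Qed.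

Lemma measurable_heat d (T : measurableType d) c j (f g : T -> R) :
  measurable_fun setT f -> measurable_fun setT g ->
  measurable_fun setT (fun x => heat c j (f x) (g x)).
Proof.
move=> mf mg; have mq : measurable_fun setT (fun x => g x / f x).
  by apply: measurable_funM => //; exact: measurable_funV.
apply: measurable_funM; last exact: measurable_fun_expRN.
apply: measurable_funM; first exact: measurable_fun_powR.
exact: (measurableT_comp (measurable_lag _ _) mq).
Qed.

(* The index is shifted by one with respect to [heat], to accommodate at index
   0 a primitive of [- heat c 0] in [a]. *)
Definition heatp c i a r :=
  if i is j.+1 then heat c j a r else r `^ (- c) * lower_gamma c (r / a).

Lemma is_derive_heatp c i a r : 0 < c -> 0 < r -> 0 < a ->
  is_derive a 1 (heatp c i ^~ r) (- heatp c i.+1 a r).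
Proof.
move=> c0 r0 a0; case: i => [|i] /=; last exact: is_derive_heat.
have H : a != 0 by rewrite gt_eqF.
have ra0 : 0 < r / a by rewrite divr_gt0.
have ? := is_derive_divl r a H.
have ? := is_derive_lower_gamma _ _ c0 ra0.
have ? : is_derive a 1 (fun b => lower_gamma c (r / b)) (gammaf c (r / a) * (- (r / a) / a)).
  exact: (@is_derive1_comp R (lower_gamma c) (fun b => r / b)).
apply: is_derive_eq; rewrite /GRing.scale/= /gammaf /heat /=.
(* All real powers are expressed through [r^(c-1)] and [a^(-(c+1))], so that [field] can
   conclude. *)
have -> : (r / a) `^ (c - 1) = r `^ (c - 1) * a `^ (- (c + 1)) * a ^+ 2.
  rewrite powRM ?invr_ge0 ?ltW// -mulrA; congr (_ * _).
  rewrite -powR_inv1 ?(ltW a0)// -powRrM -powR_mulrn ?(ltW a0)//.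
  by rewrite -powRD ?(gt_eqF a0) ?implybT//; congr (_ `^ _); ring.
have -> : r `^ (- c) = (r * r `^ (c - 1))^-1.
  by rewrite -powRS// subrK powRN.
by field; rewrite H gt_eqF ?powR_gt0// gt_eqF.
Qed.

Lemma continuous_heatp c i a r : 0 < c -> 0 < r -> 0 < a ->
  {for a, continuous (heatp c i ^~ r)}.
Proof.
move=> c0 r0 a0; have [d _] := is_derive_heatp _ i _ _ c0 r0 a0.
exact/differentiable_continuous/derivable1_diffP.
Qed.

Lemma heat_ge0 c a r : 0 <= heat c 0 a r.
Proof. by rewrite /heat mulr1 mulr_ge0 ?powR_ge0 ?expR_ge0. Qed.

Lemma cvg_divn2 r : (r / k.+2%:R : R) @[k --> \oo] --> (0 : R).
Proof. by rewrite -(mulr0 r); apply: cvgM; [exact: cvg_cst|exact: cvg_invn2]. Qed.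

(** [- heatp c 0] is a primitive in [b], and [lower_gamma c (r / b)] falls from [Gamma c] at 0 to 0
    at infinity. *)
Lemma integral_heat0 c r : 0 < c -> 0 < r ->
  (\int[mu]_(b in `]0%R, +oo[) (heat c 0 b r)%:E = (r `^ (- c) * Gamma c)%:E)%E.
Proof.
move=> c0 r0.
suff -> : r `^ (- c) * Gamma c = 0 - - (r `^ (- c) * Gamma c).
  apply: (@ge0_FTC_itv0y R (heat c 0 ^~ r) (fun b => - heatp c 0 b r)).
  - move=> b b0; have ? := is_derive_heatp _ 0 _ _ c0 r0 b0.
    by apply: is_derive_eq; rewrite opprK.
  - by move=> b b0; exact: (continuous_heatp _ 1).
  - apply: cvgN; apply: cvgM; first exact: cvg_cst.
    by under eq_fun do rewrite invrK; exact: lower_gamma_cvgy.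
  - rewrite -oppr0; apply: cvgN; rewrite -(mulr0 (r `^ (- c))).
    apply: cvgM; first exact: cvg_cst.
    exact: (cvg_comp _ _ (cvg_divn2 r) (lower_gamma_cvg0 _ c0)).
  - by move=> b b0; exact: heat_ge0.
by rewrite sub0r opprK.
Qed.

(** For [r = |x - y|^2] and [c = n/2 - 1] this is the kernel of the potential up to a factor:
    [r^(1-c) = |x - y|^(4-n)], and [c = 1] is the logarithmic case [n = 4]. *)
Definition powPrim c r := if c == 1 then ln r else r `^ (1 - c) / (1 - c).

Lemma is_derive_powPrim c r : 0 < r -> is_derive r 1 (powPrim c) (r `^ (- c)).
Proof.
move=> r0; rewrite /powPrim; have [->|c1] := eqVneq c 1.
  by rewrite powR_inv1 ?ltW//; exact: is_derive1_ln.
have ? := is_derive1_powR (1 - c) r0.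
have c1' : 1 - c != 0 by rewrite subr_eq0 eq_sym.
apply: is_derive_eq; rewrite /GRing.scale/=.
have -> : 1 - c - 1 = - c by ring.
by field.
Qed.

Definition riesz c r b := b `^ (- c) * (expR (- (r / b)) - expR (- b^-1)).

(** The difference of exponentials is the integral of [exp(-s/b) / b] over [s] in [[p, q]]. Tonelli
    exchanges the integrals, and [integral_heat0] leaves [Gamma c] times the integral of
    [s^(-c)]. *)
Lemma integral_riesz_diff c (p q : R) : 0 < c -> 0 < p -> p <= q ->
  (\int[mu]_(b in `]0%R, +oo[) (b `^ (- c) * (expR (- (p / b)) - expR (- (q / b))))%:E
   = (Gamma c * (powPrim c q - powPrim c p))%:E)%E.
Proof.
move=> c0 p0 pq; have q0 := lt_le_trans p0 pq.
pose I := `[p, q]%classic : set R.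
(* The indicators extend both integrals to the whole line, the form in which Tonelli is applied. *)
pose f (z : R * R) : \bar R := (heat c 0 z.1 z.2 * \1_D z.1 * \1_I z.2)%:E.
have f0 z : (0 <= f z)%E by rewrite lee_fin; apply: mulr_ge0;
  rewrite ?indicE ?ler0n//; apply: mulr_ge0; rewrite ?heat_ge0 ?ler0n.
have mf : measurable_fun setT f.
  apply/measurable_EFinP; apply: measurable_funM; first apply: measurable_funM.
  - exact: measurable_heat.
  - have mD : measurable_fun setT (\1_D : R -> R).
      by apply: measurable_indic; exact: measurable_itv.
    exact: (measurableT_comp mD measurable_fst).
  - have mI : measurable_fun setT (\1_I : R -> R).
      by apply: measurable_indic; exact: measurable_itv.
    exact: (measurableT_comp mI measurable_snd).
have tonelli : (\int[mu]_b \int[mu]_s f (b, s) = \int[mu]_s \int[mu]_b f (b, s))%E.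
  exact: (@fubini_tonelli _ _ _ _ _ mu mu f mf f0).
transitivity (\int[mu]_b \int[mu]_s f (b, s))%E.
  rewrite integral_mkcond; apply: eq_integral => b _; rewrite patchE.
  transitivity (\int[mu]_(s in I) (heat c 0 b s * \1_D b)%:E)%E; last first.
    by rewrite integral_mkcond epatch_indic.
  rewrite !indicE !mem_setE !in_itv/= !andbT; have [b0|_] /= := ltP 0 b; last first.
    by under eq_integral do rewrite mulr0; rewrite integral0.
  under eq_integral do rewrite mulr1.
  transitivity ((- (b `^ (- c) * expR (- (q / b))) - - (b `^ (- c) * expR (- (p / b))))%:E).
    by congr (_%:E); ring.
  apply/esym; apply: (@FTC_cc R (heat c 0 b)
    (fun s => - (b `^ (- c) * expR (- (s / b)))) p q p0 pq).
  - move=> s s0; apply: is_derive_eq; rewrite /GRing.scale/= /heat /=.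
    have -> : - c = - (c + 1) + 1 by ring.
    by rewrite (powRS _ _ b0); field; rewrite gt_eqF.
  - move=> s s0.
    have ? : is_derive s 1 (heat c 0 b) (b `^ (- (c + 1)) * (- b^-1 * expR (- (s / b)))).
      by rewrite /heat /=; apply: is_derive_eq; rewrite /GRing.scale/=; ring.
    exact/differentiable_continuous/derivable1_diffP.
rewrite tonelli.
transitivity (\int[mu]_(s in I) (Gamma c * s `^ (- c))%:E)%E.
  rewrite [RHS]integral_mkcond; apply: eq_integral => s _; rewrite patchE.
  transitivity (\int[mu]_(b in D) (heat c 0 b s * \1_I s)%:E)%E.
    rewrite [RHS]integral_mkcond epatch_indic.
    by apply: eq_integral => b _; rewrite -EFinM mulrAC.
  rewrite /I !indicE !mem_setE !in_itv/=.
  case: (boolP (p <= s <= q)) => [/andP[ps _]|_] /=; last first.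
    by under eq_integral do rewrite mulr0; rewrite integral0.
  under eq_integral do rewrite mulr1.
  by rewrite (integral_heat0 _ _ c0 (lt_le_trans p0 ps)) mulrC.
rewrite mulrBr.
apply: (@FTC_cc R (fun s => Gamma c * s `^ (- c)) (fun s => Gamma c * powPrim c s) p q p0 pq).
- by move=> s s0; have ? := is_derive_powPrim c _ s0; exact: is_derive_eq.
- by move=> s s0; apply: cvgM; [exact: cvg_cst|exact: continuous_powR].
Qed.

Lemma integral_riesz c r : 0 < c -> 0 < r ->
  (\int[mu]_(b in `]0%R, +oo[) (riesz c r b)%:E
   = (Gamma c * (powPrim c 1 - powPrim c r))%:E)%E.
Proof.
move=> c0 r0; have [r1|r1] := leP r 1.
  rewrite -(integral_riesz_diff _ _ _ c0 r0 r1); apply: eq_integral => b _.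
  by rewrite /riesz mul1r.
have h := integral_riesz_diff _ _ _ c0 ltr01 (ltW r1).
rewrite -(opprB (powPrim c r)) mulrN EFinN -h -integral_ge0N.
  by apply: eq_integral => b _; rewrite -EFinN -mulrN opprB mul1r.
move=> b; rewrite /= in_itv/= andbT => b0.
rewrite lee_fin mulr_ge0 ?powR_ge0// subr_ge0 ler_expR lerN2.
by rewrite ler_pM2r ?invr_gt0// ltW.
Qed.

(** [lag_bound] costs a quarter of the exponential decay; half of it is kept, uniformly in [a] and
    [r]. *)
Lemma heat_decay c j : exists2 C : R, 0 < C & forall a r, 0 < a -> 0 <= r ->
  `|heat c j a r| <= C * a `^ (- (c + j.+1%:R)) * expR (- (r / a / 2)).
Proof.
have [C C0 HC] := lag_bound j c; exists C => // a r a0 r0.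
have u0 : 0 <= r / a by rewrite divr_ge0// ltW.
rewrite /heat; move: (r / a) u0 => u u0.
rewrite !normrM (ger0_norm (powR_ge0 _ _)) (ger0_norm (expR_ge0 _)).
rewrite (mulrC C) -!mulrA ler_wpM2l ?powR_ge0//.
rewrite (le_trans (ler_wpM2r (expR_ge0 _) (HC _ u0)))// -(mulrA C) ler_pM2l// -expRD.
by rewrite ler_expR; lra.
Qed.

(** A boundary term at infinity, of order [k^(-(c+j))]; [c > 0] covers [j = 0]. *)
Lemma cvg_heatpS c j r : 0 < c -> 0 < r ->
  k.+2%:R * heatp c j.+1 (1 + k.+2%:R) r @[k --> \oo] --> (0 : R).
Proof.
move=> c0 r0; have [C C0 HC] := heat_decay c j.
have cj0 : 0 < c + j%:R by rewrite ltr_wpDr.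
apply: norm_cvg0.
apply: (@squeeze_cvgr _ _ _ _ (fun=> 0) (fun k => C * k.+3%:R^-1 `^ (c + j%:R))).
- apply: nearW => k; rewrite normr_ge0/=.
  have k0 : 0 < k.+3%:R :> R by [].
  rewrite nat1r normrM (ger0_norm (ler0n _ _)).
  have := HC _ _ k0 (ltW r0) => h.
  have e1 : expR (- (r / k.+3%:R / 2)) <= 1.
    by rewrite -expR0 ler_expR oppr_le0 !divr_ge0// ltW.
  rewrite (@le_trans _ _ (k.+3%:R * (C * k.+3%:R `^ (- (c + j.+1%:R)))))//.
    rewrite ler_pM// ?ler_nat//; apply: (le_trans h).
    by rewrite ler_piMr// mulr_ge0 ?powR_ge0// ltW.
  rewrite mulrCA -powRS// ler_pM2l//.
  have -> : - (c + j.+1%:R) + 1 = - (c + j%:R) by rewrite -natr1; ring.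
  by rewrite -powR_inv1// -powRrM mulN1r.
- exact: cvg_cst.
- rewrite -(mulr0 C); apply: cvgM; first exact: cvg_cst.
  by have := powR_cvg_invn2 _ cj0; rewrite -cvg_shiftS.
Qed.

Lemma cvg_heatp c j r : 0 < c -> 0 < r ->
  heatp c j (1 + k.+2%:R) r @[k --> \oo] --> (0 : R).
Proof.
move=> c0 r0; case: j => [|j].
  rewrite -(mulr0 (r `^ (- c))); apply: cvgM; first exact: cvg_cst.
  under eq_fun do rewrite nat1r.
  have h : (r / k.+3%:R : R) @[k --> \oo] --> (0 : R).
    by have := cvg_divn2 r; rewrite -cvg_shiftS.
  exact: (cvg_comp _ _ h (lower_gamma_cvg0 _ c0)).
apply: norm_cvg0.
apply: (@squeeze_cvgr _ _ _ _ (fun=> 0) (fun k => `|k.+2%:R * heatp c j.+1 (1 + k.+2%:R) r|)).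
- apply: nearW => k; rewrite normr_ge0/= [leRHS]normrM ler_peMl//.
  by rewrite ger0_norm// ler1n.
- exact: cvg_cst.
- by rewrite -(@normr0 _ R); apply: cvg_norm; exact: cvg_heatpS.
Qed.

(** Both integrations by parts at once. The primitive is minus the sum of
    [b * heatp c j.+1 (1 + b) r] and [heatp c j (1 + b) r]; it vanishes at infinity, and only the
    second term survives at [b = 0]. *)
Lemma integral_mul_heatp c j r : 0 < c -> 0 < r ->
  mu.-integrable (`]0%R, +oo[%classic : set R) (EFin \o (fun b => b * heatp c j.+2 (1 + b) r)) ->
  (\int[mu]_(b in `]0%R, +oo[) (b * heatp c j.+2 (1 + b) r)%:E = (heatp c j 1 r)%:E)%E.
Proof.
move=> c0 r0 hi.
have dh i (b : R) : 0 < b ->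
    is_derive b 1 (fun b => heatp c i (1 + b) r) (- heatp c i.+1 (1 + b) r).
  move=> b0; have b1 : 0 < 1 + b by rewrite addr_gt0.
  have ? := is_derive_heatp _ i _ _ c0 r0 b1.
  have h := is_derive_addl 1 b.
  rewrite -[X in is_derive _ _ _ X]mulr1.
  exact: (@is_derive1_comp R (heatp c i ^~ r) (fun b => 1 + b)).
have ch i : heatp c i (1 + k.+2%:R^-1) r @[k --> \oo] --> heatp c i 1 r.
  have h : (1 + k.+2%:R^-1 : R) @[k --> \oo] --> (1 : R).
    rewrite -[X in _ --> X]addr0; apply: cvgD; first exact: cvg_cst.
    exact: cvg_invn2.
  exact: (cvg_comp _ _ h (continuous_heatp _ i _ _ c0 r0 (@ltr01 R))).
rewrite -[X in _ = X%:E]opprK -sub0r.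
apply: (@integrable_FTC_itv0y R (fun b => b * heatp c j.+2 (1 + b) r)
  (fun b => - (b * heatp c j.+1 (1 + b) r) - heatp c j (1 + b) r)).
- move=> b b0; have ? := dh j _ b0; have ? := dh j.+1 _ b0.
  by apply: is_derive_eq; rewrite /GRing.scale/=; ring.
- move=> b b0; have ? := dh j.+2 _ b0.
  have ? : is_derive b 1 (fun b => b * heatp c j.+2 (1 + b) r)
      (b * - heatp c j.+3 (1 + b) r + heatp c j.+2 (1 + b) r * 1).
    exact: is_deriveM.
  exact/differentiable_continuous/derivable1_diffP.
- rewrite -[X in _ --> X]add0r -[X in X + _]oppr0; apply: cvgB; last exact: ch.
  apply: cvgN; rewrite -(mul0r (heatp c j.+1 1 r)); apply: cvgM; last exact: ch.
  exact: cvg_invn2.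
- rewrite -[X in _ --> X]subr0 -[X in X - _]oppr0; apply: cvgB; last exact: cvg_heatp.
  by apply: cvgN; exact: cvg_heatpS.
- exact: hi.
Qed.

End kernel.

(** * Convolution with a Gaussian *)

Section gaussian_convolution.
Context {R : realType}.
Variable n : nat.
Local Notation mu := (lebesgue_tuple n : {measure set (n.-tuple R) -> \bar R}).
Local Notation N := (fun y : n.-tuple R => enorm y ^+ 2).
Implicit Types (c r a b : R) (w : n.-tuple R -> R).

Lemma enorm_sqr_ge0 (y : n.-tuple R) : 0 <= enorm y ^+ 2.
Proof. exact: sqr_ge0. Qed.

Lemma measurable_edist_sqr (x : n.-tuple R) :
  measurable_fun setT (fun y : n.-tuple R => edist x y ^+ 2).
Proof.
under eq_fun do rewrite edist_sqr.
apply: measurable_sum => i; apply: measurable_funX; apply: measurable_funB => //.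
exact: measurable_tnth.
Qed.

Lemma measurable_enorm_sqr : measurable_fun setT N.
Proof.
under eq_fun do rewrite enorm_sqr.
by apply: measurable_sum => i; apply: measurable_funX; exact: measurable_tnth.
Qed.

Lemma integrable_gauss_tuple a : 0 < a ->
  mu.-integrable setT (fun y => (expR (- (enorm y ^+ 2 / a)))%:E).
Proof.
move=> a0; apply/integrableP; split.
  apply/measurable_EFinP; apply: measurable_fun_expRN; apply: measurable_funM => //.
  exact: measurable_enorm_sqr.
under eq_integral do rewrite gee0_abs ?lee_fin ?expR_ge0//.
by rewrite integral_gauss_tuple// ltry.
Qed.

(** The weight [w] stands for the constant 1 as well as for the Gaussian [exp(-|x - y|^2/b)]. *)
Lemma integrable_heat_tuple c j a w : 0 < a ->
  measurable_fun setT w -> (forall y, 0 <= w y <= 1) ->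
  mu.-integrable setT (fun y => (heat c j a (enorm y ^+ 2) * w y)%:E).
Proof.
move=> a0 mw w01; have [C C0 HC] := heat_decay c j.
have a20 : 0 < a * 2 by rewrite mulr_gt0.
pose K := C * a `^ (- (c + j.+1%:R)).
have iK : mu.-integrable setT (fun y => (K%:E * (expR (- (enorm y ^+ 2 / (a * 2))))%:E)%E).
  by apply: integrableZl => //; exact: integrable_gauss_tuple.
apply: (le_integrable _ _ _ iK) => //.
- apply/measurable_EFinP; apply: measurable_funM => //.
  by apply: measurable_heat => //; exact: measurable_enorm_sqr.
- move=> y _; rewrite -EFinM !abse_EFin lee_fin [leLHS]normrM.
  have /andP[w0 w1] := w01 y.
  rewrite (ger0_norm w0) (@ger0_norm _ (K * _)) ?mulr_ge0 ?powR_ge0 ?expR_ge0 ?(ltW C0)//.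
  rewrite (le_trans (ler_piMr _ w1))// (le_trans (HC _ _ a0 (enorm_sqr_ge0 y)))//.
  by rewrite invfM mulrA.
Qed.

Lemma integrable_heat_tuple1 c j a : 0 < a ->
  mu.-integrable setT (fun y => (heat c j a (enorm y ^+ 2))%:E).
Proof.
move=> a0; have := integrable_heat_tuple c j a (fun=> 1) a0 (measurable_cst _).
by under eq_fun do rewrite mulr1; apply; rewrite ler01 lexx.
Qed.

Lemma is_derive_integral_heat c j w a : 0 < c -> 0 < a ->
  measurable_fun setT w -> (forall y, 0 <= w y <= 1) ->
  is_derive a 1 (fun a => \int[mu]_y (heat c j a (enorm y ^+ 2) * w y))
    (- \int[mu]_y (heat c j.+1 a (enorm y ^+ 2) * w y)).
Proof.
move=> c0 a0 mw w01; have [C C0 HC] := heat_decay c j.+1.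
pose f (a : R) (y : n.-tuple R) := heat c j a (enorm y ^+ 2) * w y.
have df b y : 0 < b -> is_derive b 1 (f ^~ y) (- heat c j.+1 b (enorm y ^+ 2) * w y).
  move=> b0; have ? := is_derive_heat c j b (enorm y ^+ 2) b0.
  by apply: is_derive_eq; rewrite /GRing.scale/=; ring.
have Ia : `](a / 2), (a * 2)[%classic a.
  by rewrite /= in_itv/= ltr_pdivrMr// !ltr_pMr// !ltr1n.
have Ipos b : `](a / 2), (a * 2)[%classic b -> 0 < b.
  rewrite /= in_itv/= => /andP[h _]; apply: lt_trans h; exact: divr_gt0.
(* For parameters in []a/2, 2a[] the power in [heat_decay] is at most its value at [a/2], the
   exponential at most its value at [2a]. *)
pose K := C * (a / 2) `^ (- (c + j.+2%:R)).
pose G (y : n.-tuple R) := K * expR (- (enorm y ^+ 2 / (a * 4))).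
have a2 : 0 < a / 2 by rewrite divr_gt0.
have a4 : 0 < a * 4 by rewrite mulr_gt0.
have K0 : 0 <= K by rewrite mulr_ge0 ?powR_ge0// ltW.
have intf b : `](a / 2), (a * 2)[%classic b -> mu.-integrable setT (EFin \o f b).
  by move=> /Ipos b0; exact: integrable_heat_tuple.
have derf b y : `](a / 2), (a * 2)[%classic b -> setT y -> derivable (f ^~ y) b 1.
  by move=> /Ipos b0 _; case: (df b y b0).
have G0 y : 0 <= G y by rewrite mulr_ge0 ?expR_ge0.
have iG : mu.-integrable setT (EFin \o G).
  have h : mu.-integrable setT (fun y => (K%:E * (expR (- (enorm y ^+ 2 / (a * 4))))%:E)%E).
    by apply: integrableZl => //; exact: integrable_gauss_tuple.
  exact: h.
have Gub b y : `](a / 2), (a * 2)[%classic b -> setT y -> `|partial1of2 f b y| <= G y.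
  move=> Ib _; have b0 := Ipos _ Ib; rewrite partial1of2E.
  have [_ ->] := df b y b0; have /andP[w0 w1] := w01 y.
  rewrite normrM normrN (ger0_norm w0) (le_trans (ler_piMr _ w1))//.
  rewrite (le_trans (HC _ _ b0 (enorm_sqr_ge0 y)))// /G /K.
  move: Ib; rewrite /= in_itv/= => /andP[b1 b2].
  rewrite ler_pM ?mulr_ge0 ?powR_ge0 ?expR_ge0 ?(ltW C0)//.
    rewrite ler_pM2l// !powRN lef_pV2 ?posrE ?powR_gt0//.
    by rewrite ge0_ler_powR ?nnegrE ?addr_ge0 ?(ltW c0)// ltW.
  rewrite ler_expR lerN2 -[leRHS]mulrA ler_wpM2l ?enorm_sqr_ge0//.
  rewrite (_ : b^-1 / 2 = (b * 2)^-1) ?lef_pV2 ?posrE ?mulr_gt0// -?invfM//.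
  by apply/ltW; move: b2; lra.
have h1 := differentiation_under_integral (mu := mu) measurableT Ia intf derf G0 iG Gub.
have h2 := derivable_under_integral (mu := mu) measurableT Ia intf derf G0 iG Gub.
apply: DeriveDef; first exact: h2.
rewrite -derive1E [LHS]h1 -mulN1r -RintegralZl//; last exact: integrable_heat_tuple.
apply: eq_Rintegral => y _; rewrite partial1of2E; have [_ ->] := df a y a0.
by ring.
Qed.

(** On both sides each index is minus the derivative of the preceding one, so only the Gaussian
    integral at index 0 has to be computed. *)
Lemma integral_heat_uniq c w (J : nat -> R -> R) : 0 < c ->
  measurable_fun setT w -> (forall y, 0 <= w y <= 1) ->
  (forall j a, 0 < a -> is_derive a 1 (J j) (- J j.+1 a)) ->
  (forall a, 0 < a -> \int[mu]_y (heat c 0 a (enorm y ^+ 2) * w y) = J 0%N a) ->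
  forall j a, 0 < a -> \int[mu]_y (heat c j a (enorm y ^+ 2) * w y) = J j a.
Proof.
move=> c0 mw w01 dJ h0; elim=> [//|j IH] a a0.
apply: oppr_inj.
have [_ <-] := is_derive_integral_heat c j w a c0 a0 mw w01.
have [_ <-] := dJ j a a0.
apply: near_eq_derive; near=> b; apply: IH; near: b; exact: lt_nbhsr.
Unshelve. all: end_near. Qed.

(** The mass of [a^(-n/2) exp(-|y|^2/a)] is [pi^(n/2)] for every [a], so its derivatives in [a]
    integrate to 0. *)
Lemma integral_heat_tuple0 c j a : n%:R / 2 = c + 1 -> 0 < c -> 0 < a ->
  \int[mu]_y heat c j.+1 a (enorm y ^+ 2) = 0.
Proof.
move=> nc c0 a0.
transitivity (\int[mu]_y (heat c j.+1 a (enorm y ^+ 2) * 1)).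
  by apply: eq_Rintegral => y _; rewrite mulr1.
apply: (integral_heat_uniq c (fun=> 1)
  (fun j _ => if j is 0%N then pi `^ (c + 1) else 0)) => //.
- by move=> y; rewrite ler01 lexx.
- move=> [|i] b b0; rewrite oppr0; exact: is_derive_cst.
- move=> b b0; rewrite /Rintegral.
  under eq_integral do rewrite mulr1 /heat/= mulr1 EFinM.
  have mg : measurable_fun setT (fun y : n.-tuple R => (expR (- (enorm y ^+ 2 / b)))%:E).
    exact: measurable_int (integrable_gauss_tuple _ b0).
  rewrite ge0_integralZl ?lee_fin ?powR_ge0//.
  rewrite integral_gauss_tuple//= nc powRM ?pi_ge0 ?ltW//.
  by rewrite mulrCA powRN mulVf ?mulr1// gt_eqF// powR_gt0.
Qed.

Lemma integral_heat_conv c j a b (x : n.-tuple R) :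
  n%:R / 2 = c + 1 -> 0 < c -> 0 < a -> 0 < b ->
  \int[mu]_y (heat c j a (enorm y ^+ 2) * expR (- (edist x y ^+ 2 / b))) =
  pi `^ (c + 1) * b `^ (c + 1) * heat c j (a + b) (enorm x ^+ 2).
Proof.
move=> nc c0 a0 b0.
have mw : measurable_fun setT (fun y : n.-tuple R => expR (- (edist x y ^+ 2 / b))).
  by apply: measurable_fun_expRN; apply: measurable_funM => //; exact: measurable_edist_sqr.
apply: (integral_heat_uniq c (fun y => expR (- (edist x y ^+ 2 / b)))
  (fun j a => pi `^ (c + 1) * b `^ (c + 1) * heat c j (a + b) (enorm x ^+ 2))) => //.
- move=> y; rewrite expR_ge0 -expR0 ler_expR oppr_le0 divr_ge0 ?sqr_ge0//.
  exact: ltW.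
- move=> i d d0; have db0 : 0 < d + b by rewrite addr_gt0.
  have ? := is_derive_heat c i _ (enorm x ^+ 2) db0.
  have h : is_derive d 1 (fun t : R => t + b) 1.
    by have := is_deriveD (is_derive_id d 1) (is_derive_cst (b : R) d 1); rewrite addr0.
  have ? : is_derive d 1 (fun t => heat c i (t + b) (enorm x ^+ 2))
      (- heat c i.+1 (d + b) (enorm x ^+ 2) * 1).
    exact: (@is_derive1_comp R (heat c i ^~ (enorm x ^+ 2)) (fun t => t + b)).
  by apply: is_derive_eq; rewrite /GRing.scale/=; ring.
- move=> d d0; rewrite /Rintegral.
  have db0 : 0 < d + b by rewrite addr_gt0.
  under eq_integral do rewrite /heat/= mulr1 -mulrA EFinM.
  have mg : measurable_fun setT (fun y : n.-tuple R =>
      (expR (- (enorm y ^+ 2 / d)) * expR (- (edist x y ^+ 2 / b)))%:E).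
    apply/measurable_EFinP; apply: measurable_funM => //.
    by apply: measurable_fun_expRN; apply: measurable_funM => //; exact: measurable_enorm_sqr.
  have g0 y : setT y -> (0 <= (expR (- (enorm y ^+ 2 / d)) * expR (- (edist x y ^+ 2 / b)))%:E)%E.
    by rewrite lee_fin mulr_ge0 ?expR_ge0.
  rewrite ge0_integralZl ?lee_fin ?powR_ge0//.
  rewrite integral_gauss_conv_tuple//= nc /heat/= mulr1 !mulrA; congr (_ * _).
  have db : 0 <= d * b / (d + b) by rewrite divr_ge0 ?mulr_ge0// ltW.
  have e : (pi * (d * b / (d + b))) `^ (c + 1) =
      pi `^ (c + 1) * (d `^ (c + 1) * b `^ (c + 1) * (d + b) `^ (- (c + 1))).
    rewrite (powRM _ (pi_ge0 R) db) powRM ?mulr_ge0 ?invr_ge0 ?(ltW d0) ?(ltW b0) ?(ltW db0)//.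
    rewrite powRM ?(ltW d0) ?(ltW b0)//.
    by rewrite -[(d + b)^-1]powR_inv1 ?(ltW db0)// -powRrM mulN1r.
  have d1 := powR_gt0 (c + 1) d0.
  rewrite (_ : pi * d * b / (d + b) = pi * (d * b / (d + b))); last by rewrite !mulrA.
  by rewrite e [d `^ - _]powRN; field; rewrite gt_eqF.
Qed.

End gaussian_convolution.

(** * Positivity of the Gamma function and bounds for [riesz] *)

Section riesz_bounds.
Context {R : realType}.
Local Notation mu := (@lebesgue_measure R).
Local Notation D := (`]0%R, +oo[%classic : set R).
Implicit Types (c r b : R).

Lemma Gamma_gt0 c : 0 < c -> 0 < Gamma c.
Proof.
move=> c0; rewrite -lte_fin /Gamma /Rintegral fineK; last first.
  by apply: integrable_fin_num => //; exact: integrable_gammaf.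
have mg A : measurable_fun A (EFin \o gammaf c).
  by apply/measurable_EFinP; apply: measurable_funTS; exact: measurable_gammaf.
have k0 : 0 < expR (- 2) / 2 :> R by rewrite divr_gt0 ?expR_gt0.
apply: (@lt_le_trans _ _ (\int[mu]_(t in `[1%R, 2%R]) (expR (- 2) / 2)%:E)%E).
  rewrite integral_cst//= lebesgue_measure_itv/= lte_fin ltr1n/=.
  by rewrite -EFinB -EFinM lte_fin mulr_gt0// subr_gt0 ltr1n.
apply: (@le_trans _ _ (\int[mu]_(t in `[1%R, 2%R]) (gammaf c t)%:E)%E).
  apply: ge0_le_integral; [by []| |by []| |].
  - by move=> t _; rewrite lee_fin ltW.
  - exact: mg.
  - move=> t; rewrite /= in_itv/= => /andP[t1 t2].
    rewrite lee_fin /gammaf mulrC ler_pM ?expR_ge0 ?ler_expR ?lerN2//.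
    have t0 : 0 < t by rewrite (lt_le_trans _ t1).
    (* With [t <= 2] this yields [t^(c-1) >= 1/2], whether or not [c >= 1]. *)
    have tc : 1 <= t `^ c by rewrite -(powRr0 t) ler_powR// ltW.
    have := @powRS R (c - 1) t t0; rewrite subrK => tE.
    have := powR_gt0 (c - 1) t0; nra.
apply: ge0_subset_integral => //.
- exact: mg.
- by move=> t _; rewrite lee_fin gammaf_ge0.
- by move=> t; rewrite /= !in_itv/= andbT => /andP[t1 _]; rewrite (lt_le_trans _ t1).
Qed.

Lemma integrable_heat0 c r : 0 < c -> 0 < r ->
  mu.-integrable D (EFin \o (heat c 0 ^~ r)).
Proof.
move=> c0 r0; apply/integrableP; split.
  by apply/measurable_EFinP; apply: measurable_funTS; exact: measurable_heat.
under eq_integral do rewrite gee0_abs ?lee_fin ?heat_ge0//.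
by rewrite integral_heat0// ltry.
Qed.

(** Triangle inequality for [b <= 1]; for [b > 1] both exponentials lie between [1 - (r+1)/b] and 1.
    The last term stays a Gaussian in the distance, since integrating it over [y] gains powers of
    [b] that offset [b^(-c)]. *)
Lemma riesz_bound c r b : 0 < c -> 0 < b -> 0 <= r ->
  `|riesz c r b| <= (r + 1) * (expR 1 * heat c 0 b 1) +
                    \1_`]0%R, 1%R] b * (b `^ (- c) * expR (- (r / b))).
Proof.
move=> c0 b0 r0; rewrite /riesz normrM (ger0_norm (powR_ge0 _ _)).
have pE : b `^ (- c) = b * b `^ (- (c + 1)).
  by rewrite -powRS//; congr (_ `^ _); ring.
have p0 := powR_gt0 (- (c + 1)) b0.
have e1 : 1 <= expR 1 :> R by rewrite -expR0 ler_expR.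
have hE : heat c 0 b 1 = b `^ (- (c + 1)) * expR (- b^-1).
  by rewrite /heat /= mulr1 mul1r.
have bV : 0 < b^-1 by rewrite invr_gt0.
have rb : 0 <= r / b by rewrite mulr_ge0// ltW.
have E1 := expR_gt0 (- (r / b)); have E2 := expR_gt0 (- b^-1).
rewrite indicE mem_setE in_itv/= b0/=; case: (leP b 1) => b1 /=.
  rewrite mul1r (le_trans (ler_wpM2l (powR_ge0 _ _) (ler_normB _ _)))//.
  rewrite !ger0_norm ?expR_ge0// mulrDr addrC lerD2r hE pE.
  have q0 : 0 < b `^ (- (c + 1)) * expR (- b^-1) by rewrite mulr_gt0.
  have k1 : 1 <= (r + 1) * expR 1 by nra.
  rewrite -mulrA [leRHS]mulrA ler_pM2r//; exact: le_trans k1.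
rewrite mul0r addr0 pE hE.
have d : `|expR (- (r / b)) - expR (- b^-1)| <= (r + 1) / b.
  have h1 := expR_ge1Dx (- (r / b)); have h2 := expR_ge1Dx (- b^-1).
  have h3 : expR (- (r / b)) <= 1 by rewrite -expR0 ler_expR oppr_le0.
  have h4 : expR (- b^-1) <= 1 by rewrite -expR0 ler_expR oppr_le0 ltW.
  by rewrite ler_norml mulrDl mul1r; apply/andP; split; lra.
rewrite (le_trans (ler_wpM2l _ d)) ?mulr_ge0 ?(ltW b0) ?(ltW p0)//.
have -> : b * b `^ (- (c + 1)) * ((r + 1) / b) = (r + 1) * b `^ (- (c + 1)).
  by field; rewrite gt_eqF.
rewrite ler_wpM2l ?addr_ge0// mulrCA -[leLHS]mulr1 ler_pM2l// -expRD.
by rewrite -[leLHS]expR0 ler_expR subr_ge0 invf_le1// ltW.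
Qed.

Lemma integrable_riesz c r : 0 < c -> 0 < r -> mu.-integrable D (EFin \o riesz c r).
Proof.
move=> c0 r0.
have i1 := integrable_heat0 _ _ c0 (@ltr01 R); have i2 := integrable_heat0 _ _ c0 r0.
have i : mu.-integrable D
    (fun b => ((r + 1) * expR 1)%:E * (heat c 0 b 1)%:E + (heat c 0 b r)%:E)%E.
  by apply: integrableD => //; exact: integrableZl.
apply: (le_integrable _ _ _ i) => //.
  apply/measurable_EFinP; apply: measurable_funTS.
  apply: measurable_funM; first exact: measurable_fun_powR.
  apply: measurable_funB; apply: measurable_fun_expRN;
    by [apply: measurable_funM => //; exact: measurable_inv|exact: measurable_inv].
move=> b; rewrite /= in_itv/= andbT => b0.
rewrite /= lee_fin [leRHS]ger0_norm; last first.
  apply: addr_ge0; last exact: heat_ge0.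
  apply: mulr_ge0; last exact: heat_ge0.
  by rewrite mulr_ge0 ?expR_ge0// addr_ge0// ltW.
rewrite (le_trans (riesz_bound _ _ _ c0 b0 (ltW r0)))// mulrA lerD2l.
rewrite indicE mem_setE in_itv/= b0/=; case: (leP b 1) => b1 /=; last first.
  by rewrite mul0r heat_ge0.
rewrite mul1r /heat /= mulr1 ler_pM2r ?expR_gt0//.
have -> : - c = - (c + 1) + 1 by ring.
by rewrite powRS// ler_piMl ?powR_ge0.
Qed.

End riesz_bounds.

(** * Exchange of the integrals *)

Lemma half_dim_gt0 (R : realType) n (c : R) : n%:R / 2 = c + 1 -> 0 < c -> (0 < n)%N.
Proof.
move=> nc c0; rewrite lt0n; apply/eqP => n0; move: nc; rewrite n0 mul0r => h.
by have : 0 < c + 1 by [rewrite addr_gt0]; rewrite -h ltxx.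
Qed.

Section riesz_potential.
Context {R : realType}.
Variables (n : nat) (c : R) (x : n.-tuple R).
Hypotheses (nc : n%:R / 2 = c + 1) (c0 : 0 < c).
Local Notation mu := (lebesgue_tuple n : {measure set (n.-tuple R) -> \bar R}).
Local Notation leb := (@lebesgue_measure R).
Local Notation D := (`]0%R, +oo[%classic : set R).
Implicit Types (j : nat) (b : R) (y : n.-tuple R).

Lemma edist_sqr_le y : edist x y ^+ 2 <= 2 * enorm x ^+ 2 + 2 * enorm y ^+ 2.
Proof.
rewrite edist_sqr !enorm_sqr !mulr_sumr -big_split/= ler_sum// => i _.
by have := sqr_ge0 (tnth x i + tnth y i); rewrite !expr2; nra.
Qed.

Lemma heat_edist_bound j : exists2 K : R, 0 < K & forall y,
  `|heat c j 1 (enorm y ^+ 2)| * (edist x y ^+ 2 + 1) <= K * expR (- (enorm y ^+ 2 / 4)).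
Proof.
have [C C0 HC] := heat_decay c j.
(* With [u = |y|^2] and [v = |x|^2], [2v + 2u + 1] is at most [(9 + 2v)(1 + u/4)], hence at most
   [(9 + 2v) exp(u/4)]. *)
exists (C * (9 + 2 * enorm x ^+ 2)) => [|y].
  by rewrite mulr_gt0// ltr_wpDr// mulr_ge0// sqr_ge0.
have Nx0 := sqr_ge0 (enorm x); have N0 := sqr_ge0 (enorm y).
have := HC 1 (enorm y ^+ 2) ltr01 N0.
rewrite powR1 mulr1 divr1 => h.
have d := edist_sqr_le y.
set u := enorm y ^+ 2 in h d N0 *; set v := enorm x ^+ 2 in d Nx0 *.
have e1 : expR (- (u / 2)) = expR (- (u / 4)) * expR (- (u / 4)).
  by rewrite -expRD; congr expR; lra.
have e2 : (9 + 2 * v) * expR (u / 4) >= edist x y ^+ 2 + 1.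
  have := expR_ge1Dx (u / 4); nra.
have e3 : expR (u / 4) * expR (- (u / 4)) = 1 by rewrite -expRD subrr expR0.
have e0 := expR_gt0 (- (u / 4)).
apply: (@le_trans _ _ (C * expR (- (u / 2)) * ((9 + 2 * v) * expR (u / 4)))).
  by rewrite ler_pM// addr_ge0// sqr_ge0.
rewrite -[leRHS]mulr1 -[X in _ <= _ * X]e3 e1; rewrite le_eqVlt; apply/predU1P; left; ring.
Qed.

Let n_gt0 : (0 < n)%N := half_dim_gt0 _ _ _ nc c0.

(** Extended by 0 to [b <= 0], so that Fubini applies on the whole product space. *)
Let F j (z : R * n.-tuple R) : R :=
  heat c j 1 (enorm z.2 ^+ 2) * riesz c (edist x z.2 ^+ 2) z.1 * \1_D z.1.

Lemma measurable_riesz d (T : measurableType d) (f g : T -> R) :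
  measurable_fun setT f -> measurable_fun setT g ->
  measurable_fun setT (fun t => riesz c (f t) (g t)).
Proof.
move=> mf mg; apply: measurable_funM; first exact: measurable_fun_powR.
have mi := measurable_funV _ _ _ mg.
by apply: measurable_funB; apply: measurable_fun_expRN => //; exact: measurable_funM.
Qed.

Let measurable_F j : measurable_fun setT (F j).
Proof.
have mN : measurable_fun setT (fun z : R * n.-tuple R => enorm z.2 ^+ 2).
  exact: (measurableT_comp (measurable_enorm_sqr n) measurable_snd).
have mE : measurable_fun setT (fun z : R * n.-tuple R => edist x z.2 ^+ 2).
  exact: (measurableT_comp (measurable_edist_sqr n x) measurable_snd).
apply: measurable_funM; first apply: measurable_funM.
- exact: measurable_heat.
- exact: measurable_riesz.
- have mD : measurable_fun setT (\1_D : R -> R).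
    by apply: measurable_indic; exact: measurable_itv.
  exact: (measurableT_comp mD measurable_fst).
Qed.

Let measurable_absF j : measurable_fun setT (fun z => (`|F j z|)%:E).
Proof. by apply/measurable_EFinP; exact: measurableT_comp. Qed.

(** The two terms of [riesz_bound] are integrated in [y]: [heat_edist_bound] absorbs the linear
    growth of the first, and the convolution of Gaussians treats the second. *)
Let F_bound j : exists A B : R, forall b,
  (\int[mu]_y `|F j (b, y)|%:E <= (A * (heat c 0 b 1 * \1_D b) + B * \1_`]0%R, 1%R] b)%:E)%E.
Proof.
have [K K0 HK] := heat_edist_bound j.
pose V := (pi * 4) `^ (c + 1) : R.
exists (K * expR 1 * V), (K * pi `^ (c + 1)) => b.
have [b0|b0] := ltP 0 b; last first.
  under eq_integral do rewrite /F indicE mem_setE in_itv/= andbT (le_gtF b0) mulr0 normr0.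
  rewrite integral0 lee_fin !indicE !mem_setE !in_itv/= (le_gtF b0)/= !mulr0 add0r//.
have gi a := integral_gauss_tuple n a.
pose theta : R := \1_`]0%R, 1%R] b * b `^ (- c).
have th0 : 0 <= theta by rewrite mulr_ge0 ?powR_ge0// indicE ler0n.
pose H1 y : R := K * expR 1 * heat c 0 b 1 * expR (- (enorm y ^+ 2 / 4)).
pose H2 y : R := K * theta * (expR (- (enorm y ^+ 2 / 4)) * expR (- (edist x y ^+ 2 / b))).
have m1 : measurable_fun setT (fun y : n.-tuple R => (expR (- (enorm y ^+ 2 / 4)))%:E).
  exact: measurable_int (integrable_gauss_tuple n 4 _).
have m2 : measurable_fun setT (fun y : n.-tuple R =>
    (expR (- (enorm y ^+ 2 / 4)) * expR (- (edist x y ^+ 2 / b)))%:E).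
  apply/measurable_EFinP; apply: measurable_funM; first exact/measurable_EFinP.
  by apply: measurable_fun_expRN; apply: measurable_funM => //; exact: measurable_edist_sqr.
have k1 : 0 <= K * expR 1 * heat c 0 b 1.
  by apply: mulr_ge0; rewrite ?heat_ge0// mulr_ge0 ?expR_ge0 ?(ltW K0).
have k2 : 0 <= K * theta by rewrite mulr_ge0// ltW.
have I1 : (\int[mu]_y (H1 y)%:E = (K * expR 1 * heat c 0 b 1 * V)%:E)%E.
  under eq_integral do rewrite EFinM.
  by rewrite ge0_integralZl ?lee_fin// gi// nc.
have p0 y : (0 <= (expR (- (enorm y ^+ 2 / 4)) * expR (- (edist x y ^+ 2 / b)))%:E)%E.
  by rewrite lee_fin mulr_ge0 ?expR_ge0.
have I2 : (\int[mu]_y (H2 y)%:E <= (K * pi `^ (c + 1) * \1_`]0%R, 1%R] b)%:E)%E.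
  under eq_integral do rewrite EFinM.
  rewrite ge0_integralZl ?lee_fin//.
  rewrite integral_gauss_conv_tuple// nc -EFinM lee_fin /theta.
  rewrite !indicE mem_setE in_itv/= b0/=.
  case: (leP b 1) => b1 /=; last by rewrite !(mul0r, mulr0).
  have b4 : 0 < 4 + b by rewrite addr_gt0.
  have q0 : 0 <= 4 * b / (4 + b) by rewrite divr_ge0 ?mulr_ge0// ltW.
  (* From [4b / (4 + b) <= b]; the power [b^(c+1)] then turns [b^(-c)] into [b], at most 1 here. *)
  have h1 : (pi * (4 * b / (4 + b))) `^ (c + 1) <= pi `^ (c + 1) * b `^ (c + 1).
    rewrite -powRM ?pi_ge0 ?(ltW b0)//; apply: ge0_ler_powR.
    - by rewrite addr_ge0// ltW.
    - by rewrite nnegrE mulr_ge0 ?pi_ge0.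
    - by rewrite nnegrE mulr_ge0 ?pi_ge0// ltW.
    rewrite ler_pM2l ?pi_gt0// ler_pdivrMr// mulrC ler_pM2l// lerDl ltW//.
  have h2 : expR (- (enorm x ^+ 2 / (4 + b))) <= 1.
    by rewrite -[leRHS]expR0 ler_expR oppr_le0 divr_ge0 ?sqr_ge0// ltW.
  have h3 : b `^ (- c) * b `^ (c + 1) = b.
    by rewrite -powRD ?(gt_eqF b0) ?implybT// addrA addNr add0r powRr1// ltW.
  rewrite mul1r mulr1 -(mulrA K) ler_pM2l//.
  apply: (@le_trans _ _ (b `^ (- c) * (pi `^ (c + 1) * b `^ (c + 1) * 1))).
    by rewrite ler_wpM2l ?powR_ge0// ler_pM ?powR_ge0 ?expR_ge0.
  by rewrite mulr1 mulrCA h3 ler_piMr ?powR_ge0.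
have mH1 : measurable_fun setT (fun y => (H1 y)%:E).
  by apply/measurable_EFinP; apply: measurable_funM => //; exact/measurable_EFinP.
have mH2 : measurable_fun setT (fun y => (H2 y)%:E).
  by apply/measurable_EFinP; apply: measurable_funM => //; exact/measurable_EFinP.
have H10 y : 0 <= H1 y by rewrite mulr_ge0 ?expR_ge0.
have H20 y : 0 <= H2 y by rewrite mulr_ge0// mulr_ge0 ?expR_ge0.
apply: (@le_trans _ _ (\int[mu]_y ((H1 y)%:E + (H2 y)%:E))%E).
  apply: ge0_le_integral; [by []| by []| | |].
  - apply/measurable_EFinP; apply: measurableT_comp => //.
    exact: (measurableT_comp (measurable_F j) (pair1_measurable b)).
  - exact: emeasurable_funD.
  - move=> y _; rewrite -EFinD lee_fin /F /= normrM.
    rewrite (@ger0_norm _ (\1_D b)) ?indicE ?ler0n//.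
    rewrite mem_setE in_itv/= andbT b0 /= mulr1 normrM.
    have r0 := sqr_ge0 (edist x y).
    have g0 := expR_gt0 (- (enorm y ^+ 2 / 4)).
    apply: (le_trans (ler_wpM2l (normr_ge0 _) (riesz_bound _ _ _ c0 b0 r0))).
    rewrite mulrDr; apply: lerD.
      have q0 : 0 <= expR 1 * heat c 0 b 1 by rewrite mulr_ge0 ?expR_ge0 ?heat_ge0.
      have -> : H1 y = K * expR (- (enorm y ^+ 2 / 4)) * (expR 1 * heat c 0 b 1).
        by rewrite /H1; ring.
      by rewrite [leLHS]mulrA; exact: ler_wpM2r q0 _ _ (HK y).
    have hy : `|heat c j 1 (enorm y ^+ 2)| <= K * expR (- (enorm y ^+ 2 / 4)).
      by apply: le_trans (HK y); rewrite ler_peMr// lerDr.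
    have -> : H2 y = K * expR (- (enorm y ^+ 2 / 4)) * (theta * expR (- (edist x y ^+ 2 / b))).
      by rewrite /H2; ring.
    rewrite (mulrA _ (b `^ (- c))) -/theta.
    have q0 : 0 <= theta * expR (- (edist x y ^+ 2 / b)) by rewrite mulr_ge0 ?expR_ge0.
    exact: ler_wpM2r q0 _ _ hy.
rewrite ge0_integralD//; last 2 first.
- by move=> y _; rewrite lee_fin.
- by move=> y _; rewrite lee_fin.
rewrite I1 (le_trans (leeD2l _ I2))// -EFinD lee_fin.
rewrite [X in _ * (_ * X)]indicE mem_setE in_itv/= andbT b0 mulr1 lerD2r.
by rewrite le_eqVlt; apply/predU1P; left; ring.
Qed.

(** Tonelli's criterion with the inner integral over [y], dominated by the function of [b] in
    [F_bound]. *)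
Let integrable_F j : (leb \x mu)%E.-integrable setT (fun z => (F j z)%:E).
Proof.
have [A [B HAB]] := F_bound j.
have i1 : leb.-integrable setT (fun b => (heat c 0 b 1 * \1_D b)%:E).
  have := integrable_heat0 c 1 c0 ltr01; rewrite integrable_mkcond//.
  by rewrite epatch_indic.
have i2 : leb.-integrable setT (fun b => (\1_(`]0%R, 1%R] : set R) b)%:E).
  exact: (integrable_indic_itv 0 1 false false).
have iM : leb.-integrable setT
    (fun b => (A%:E * (heat c 0 b 1 * \1_D b)%:E + B%:E * (\1_(`]0%R, 1%R] : set R) b)%:E)%E).
  by apply: integrableD => //; exact: integrableZl.
have mF : measurable_fun setT (fun z => (F j z)%:E) by apply/measurable_EFinP.
apply/(integrable12ltyP leb (lebesgue_tuple n) mF).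
have [mM] := integrableP _ _ _ iM; apply: le_lt_trans.
apply: ge0_le_integral; [by []| | | |].
- by move=> b _; apply: integral_ge0 => y _; rewrite lee_fin.
- apply: (measurable_fun_fubini_tonelli_F (m2 := lebesgue_tuple n) (fun z => (`|F j z|)%:E)).
  + exact: measurable_absF.
  + by move=> z; rewrite lee_fin.
- exact: measurableT_comp.
- move=> b _; apply: le_trans (HAB b) _.
  by rewrite -!EFinM -EFinD abse_EFin lee_fin ler_norm.
Qed.

Let V j y := heat c j 1 (enorm y ^+ 2) *
  (Gamma c * (powPrim c 1 - powPrim c (edist x y ^+ 2))).

Lemma edist_sqr_gt0 y : y <> x -> 0 < edist x y ^+ 2.
Proof.
move=> yx; rewrite lt0r sqr_ge0 andbT edist_sqr psumr_eq0; last first.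
  by move=> i _; exact: sqr_ge0.
apply/negP => /allP h; apply: yx; apply/eq_from_tnth => i; apply/eqP.
have := h i (mem_index_enum _); rewrite sqrf_eq0 subr_eq0 => /eqP->.
exact: eqxx.
Qed.

Lemma enorm_sqr_gt0 y : y <> origin n -> 0 < enorm y ^+ 2.
Proof.
move=> y0; rewrite lt0r sqr_ge0 andbT enorm_sqr psumr_eq0; last first.
  by move=> i _; exact: sqr_ge0.
apply/negP => /allP h; apply: y0; apply/eq_from_tnth => i; apply/eqP.
by have := h i (mem_index_enum _); rewrite sqrf_eq0 tnth_mktuple.
Qed.

Let integral_F_b j y : y <> x -> (\int[leb]_b (F j (b, y))%:E = (V j y)%:E)%E.
Proof.
move=> yx; have r0 := edist_sqr_gt0 y yx.
transitivity (\int[leb]_(b in D)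
    ((heat c j 1 (enorm y ^+ 2))%:E * (riesz c (edist x y ^+ 2) b)%:E))%E.
  by rewrite [RHS]integral_mkcond epatch_indic.
by rewrite integralZl//; [rewrite integral_riesz|exact: integrable_riesz].
Qed.

(** The term [exp(-1/b)] drops out since [heat c j.+1] integrates to 0, whence the index [j.+1]. In
    the other term [b^(-c)] and the factor [b^(c+1)] of the convolution leave [b]. *)
Let integral_F_y j b : 0 < b -> (\int[mu]_y (F j.+1 (b, y))%:E =
  (pi `^ (c + 1) * (b * heatp c j.+2 (1 + b) (enorm x ^+ 2)))%:E)%E.
Proof.
move=> b0.
have mw : measurable_fun setT (fun y : n.-tuple R => expR (- (edist x y ^+ 2 / b))).
  by apply: measurable_fun_expRN; apply: measurable_funM => //; exact: measurable_edist_sqr.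
have w01 y : 0 <= expR (- (edist x y ^+ 2 / b)) <= 1.
  by rewrite expR_ge0 -expR0 ler_expR oppr_le0 divr_ge0 ?sqr_ge0// ltW.
have i1 := integrable_heat_tuple n c j.+1 1 _ ltr01 mw w01.
have i2 : mu.-integrable setT (fun y => (heat c j.+1 1 (enorm y ^+ 2))%:E).
  exact: integrable_heat_tuple1.
have e1 := integral_heat_conv n c j.+1 1 b x nc c0 ltr01 b0.
have e2 := integral_heat_tuple0 n c j 1 nc c0 ltr01.
have E1 : (\int[mu]_y (heat c j.+1 1 (enorm y ^+ 2) * expR (- (edist x y ^+ 2 / b)))%:E =
   (pi `^ (c + 1) * b `^ (c + 1) * heat c j.+1 (1 + b) (enorm x ^+ 2))%:E)%E.
  by rewrite -e1 /Rintegral fineK//; exact: integrable_fin_num.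
have E2 : (\int[mu]_y (heat c j.+1 1 (enorm y ^+ 2))%:E = 0)%E.
  by rewrite -[LHS]fineK ?[fine _]e2//; exact: integrable_fin_num.
transitivity (\int[mu]_y ((b `^ (- c))%:E *
      (heat c j.+1 1 (enorm y ^+ 2) * expR (- (edist x y ^+ 2 / b)))%:E
    - (b `^ (- c) * expR (- b^-1))%:E * (heat c j.+1 1 (enorm y ^+ 2))%:E))%E.
  apply: eq_integral => y _; rewrite /F /riesz indicE mem_setE in_itv/= andbT b0.
  by rewrite -!EFinM -EFinB; congr (_%:E); rewrite mulr1; ring.
rewrite integralB//; last 2 first.
- exact: integrableZl.
- exact: integrableZl.
rewrite !integralZl// E1 E2 mule0 sube0 -EFinM; congr (_%:E) => /=.
have -> : b `^ (c + 1) = b * b `^ c by exact: powRS.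
by rewrite powRN; field; rewrite gt_eqF// powR_gt0.
Qed.

Lemma measurable_powPrim : measurable_fun setT (powPrim c).
Proof.
rewrite /powPrim; case: (c == 1); first exact: measurable_ln.
by apply: measurable_funM => //; exact: measurable_powR.
Qed.

Let measurable_V j : measurable_fun setT (V j).
Proof.
apply: measurable_funM.
  by apply: measurable_heat => //; exact: measurable_enorm_sqr.
apply: measurable_funM => //; apply: measurable_funB => //.
exact: (measurableT_comp measurable_powPrim (measurable_edist_sqr n x)).
Qed.

Let integrable_G j : mu.-integrable setT (fun y => \int[leb]_b (F j (b, y))%:E)%E.
Proof.
have mF : measurable_fun setT (fun z => (F j z)%:E) by apply/measurable_EFinP.
have mG := measurable_fubini_G (integrable_F j).
apply/integrableP; split; first exact: mG.
apply: le_lt_trans ((integrable21ltyP leb (lebesgue_tuple n) mF).1 (integrable_F j)).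
apply: ge0_le_integral; [by []| by []| | |].
- by apply: measurableT_comp => //; exact: mG.
- apply: (measurable_fun_fubini_tonelli_G (m1 := leb) (fun z => (`|F j z|)%:E)).
  + exact: measurable_absF.
  + by move=> z; rewrite lee_fin.
- move=> y _; apply: le_abse_integral => //.
  by apply/measurable_EFinP; exact: (measurableT_comp (measurable_F j) (pair2_measurable y)).
Qed.

Let integrable_V j : mu.-integrable setT (EFin \o V j).
Proof.
apply: (integrable_off_point n x _ _ n_gt0 _ _ (integrable_G j)).
- exact/measurable_EFinP.
- by move=> y yx; exact: integral_F_b.
Qed.

(** Solving the definition of [V] for [powPrim] transfers the integrability of [V], a by-product of
    Fubini. Index 0, the Gaussian itself, is included. *)
Lemma integrable_heat_powPrim j :
  mu.-integrable setT (fun y => (heat c j 1 (enorm y ^+ 2) * powPrim c (edist x y ^+ 2))%:E).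
Proof.
have G0 := Gamma_gt0 _ c0.
have i2 : mu.-integrable setT (fun y => (heat c j 1 (enorm y ^+ 2))%:E).
  exact: integrable_heat_tuple1.
have := integrableB measurableT (integrableZl measurableT (powPrim c 1) i2)
  (integrableZl measurableT (Gamma c)^-1 (integrable_V j)).
apply: eq_integrable => // y _; rewrite -!EFinM -EFinB; congr (_%:E).
by rewrite /V; field; rewrite gt_eqF.
Qed.

(** Integrating [F] over [b] gives [V], whose constant [powPrim c 1] has no effect on a density of
    integral 0. Integrating over [y] first leads to [integral_mul_heatp], which requires
    [|x|^2 > 0]. *)
Lemma integral_heat_powPrim j : x <> origin n ->
  - Gamma c * \int[mu]_y (heat c j.+1 1 (enorm y ^+ 2) * powPrim c (edist x y ^+ 2)) =
  pi `^ (c + 1) * heatp c j 1 (enorm x ^+ 2).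
Proof.
move=> x0.
have r0 := enorm_sqr_gt0 _ x0.
have i2 : mu.-integrable setT (fun y => (heat c j.+1 1 (enorm y ^+ 2))%:E).
  exact: integrable_heat_tuple1.
have e2 := integral_heat_tuple0 n c j 1 nc c0 ltr01.
transitivity (\int[mu]_y V j.+1 y).
  rewrite (_ : \int[mu]_y V j.+1 y =
    \int[mu]_y (Gamma c * powPrim c 1 * heat c j.+1 1 (enorm y ^+ 2)
    - Gamma c * (heat c j.+1 1 (enorm y ^+ 2) * powPrim c (edist x y ^+ 2)))); last first.
    by apply: eq_Rintegral => y _; rewrite /V; ring.
  rewrite RintegralB//; last 2 first.
  - exact: (integrableZl measurableT _ i2).
  - exact: (integrableZl measurableT _ (integrable_heat_powPrim _)).
  rewrite !RintegralZl//; last exact: integrable_heat_powPrim.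
  by rewrite e2 mulr0 sub0r mulNr.
have pp : 0 < pi `^ (c + 1) :> R by rewrite powR_gt0// pi_gt0.
pose h b := b * heatp c j.+2 (1 + b) (enorm x ^+ 2).
(* The integrability needed by [integral_mul_heatp] comes from Fubini, as this is the inner integral
   of [F]. *)
have ph : leb.-integrable D (fun b => (pi `^ (c + 1) * h b)%:E).
  have h2 := integrable_fubini_F (integrable_F j.+1).
  have : leb.-integrable D (fubini_F mu (fun z => (F j.+1 z)%:E)).
    by apply: (integrableS _ _ _ h2).
  apply: eq_integrable => // b; rewrite inE/= in_itv/= andbT => b0.
  exact: integral_F_y.
have hi : leb.-integrable D (EFin \o h).
  have : leb.-integrable D (fun b => ((pi `^ (c + 1))^-1)%:E * (pi `^ (c + 1) * h b)%:E)%E.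
    exact: integrableZl.
  apply: eq_integrable => // b _; rewrite -EFinM; congr (_%:E).
  by rewrite mulrA mulVf ?mul1r// gt_eqF.
rewrite /Rintegral -(@ae_eq_integral _ _ _ _ _ (EFin \o V j.+1)
  (fun y => \int[leb]_b (F j.+1 (b, y))%:E)%E)//; last 3 first.
- exact: measurable_int (integrable_G j.+1).
- exact/measurable_EFinP.
- by apply: (ae_eq_off_point n x _ _ n_gt0) => y yx; exact: integral_F_b.
rewrite -(Fubini (integrable_F j.+1)).
transitivity (fine (\int[leb]_(b in D) (pi `^ (c + 1) * h b)%:E)%E).
  congr fine; rewrite [RHS]integral_mkcond; apply: eq_integral => b _; rewrite patchE.
  rewrite mem_setE in_itv/= andbT; have [b0|b0] := ltP 0 b; first exact: integral_F_y.
  under eq_integral do rewrite /F indicE mem_setE in_itv/= andbT (le_gtF b0) mulr0.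
  by rewrite integral0.
under eq_integral do rewrite EFinM.
by rewrite integralZl// integral_mul_heatp.
Qed.

End riesz_potential.

(** * The biharmonic potential *)

Section biharmonic.
Context {R : realType}.
Variables (n : nat) (c : R) (x : n.-tuple R).
Hypotheses (nc : n%:R / 2 = c + 1) (c0 : 0 < c).
Local Notation mu := (lebesgue_tuple n : {measure set (n.-tuple R) -> \bar R}).
Implicit Types (f A B : n.-tuple R -> R).

Lemma measurable_edist : measurable_fun setT (edist x).
Proof.
have -> : edist x = fun y => (edist x y ^+ 2) `^ 2^-1.
  by apply/funext => y; rewrite powR12_sqrt ?sqr_ge0// sqrtr_sqr ger0_norm// sqrtr_ge0.
by apply: measurable_fun_powR; exact: measurable_edist_sqr.
Qed.

Lemma measurable_fun_exprz d (T : measurableType d) (g : T -> R) (z : int) :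
  measurable_fun setT g -> measurable_fun setT (fun t => g t ^ z).
Proof.
move=> mg; case: z => k; first exact: measurable_funX.
by apply: measurable_funV; exact: measurable_funX.
Qed.

(** One formula for both definitions. For [n = 4], [ln |x - y|] is half of [ln |x - y|^2]. Otherwise
    [Gamma (c + 1) = c * Gamma c], [n - 2 = 2c] and [n - 4 = -2(1 - c)], and [1 - c] cancels against
    [powPrim]. *)
Lemma biharmonic_potentialE f : measurable_fun setT f ->
  mu.-integrable setT (fun y => (f y * powPrim c (edist x y ^+ 2))%:E) ->
  biharmonic_potential f x =
  - Gamma c / (16 * pi `^ (c + 1)) * \int[mu]_y (f y * powPrim c (edist x y ^+ 2)).
Proof.
move=> mf fi; rewrite /biharmonic_potential; case: eqVneq => [n4|n4].
  have c1 : c = 1 by move: nc; rewrite n4; lra.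
  rewrite (_ : \int[lebesgue_tuple n]_y (ln (edist x y) * f y) =
      \int[mu]_y (2^-1 * (f y * powPrim c (edist x y ^+ 2)))); last first.
    apply: eq_Rintegral => y _; rewrite /powPrim c1 eqxx.
    (* At zero distance both sides vanish by the convention [ln 0 = 0]. *)
    have [->|d0] := eqVneq (edist x y) 0; first by rewrite expr0n/= ln0// !(mul0r, mulr0).
    by rewrite lnXn ?lt0r ?d0 ?sqrtr_ge0// -mulr_natr; field.
  rewrite RintegralZl// c1 Gamma1 -[1 + 1]/(2%:R) powR_mulrn ?pi_ge0//.
  by move: (pi : R) (pi_gt0 R) => p p0; field; rewrite gt_eqF.
have c1 : 1 - c != 0.
  rewrite subr_eq0; apply: contra n4 => /eqP c1; move: nc; rewrite -c1 => h.
  by rewrite -(eqr_nat R); apply/eqP; lra.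
rewrite (Rintegral_off_point n x (fun y => f y / edist x y ^ (n%:Z - 4))
  (fun y => (1 - c) * (f y * powPrim c (edist x y ^+ 2))) (half_dim_gt0 _ _ _ nc c0)).
- rewrite RintegralZl// nc GammaS//.
  have -> : n%:R = 2 * (c + 1) :> R by rewrite -nc; field.
  have p0 : 0 < pi `^ (c + 1) :> R by rewrite powR_gt0// pi_gt0.
  have -> : 2 * (c + 1) - 2 = 2 * c by ring.
  have -> : 2 * (c + 1) - 4 = - 2 * (1 - c) by ring.
  move: (1 - c) c1 (pi `^ (c + 1)) p0 => t t0 p p0.
  by field; rewrite t0 !gt_eqF.
- apply: measurable_funM => //; apply: measurable_funV; apply: measurable_fun_exprz.
  exact: measurable_edist.
- by apply: measurable_funM => //; apply/measurable_EFinP; exact: measurable_int fi.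
- move=> y yx; have r0 := edist_sqr_gt0 n x y yx.
  have d0 : 0 < edist x y by rewrite lt0r sqrtr_ge0 andbT -sqrf_eq0 gt_eqF.
  rewrite /powPrim (_ : (c == 1) = false); last first.
    by apply/negbTE; rewrite eq_sym -subr_eq0.
  have -> : (edist x y ^+ 2) `^ (1 - c) = (edist x y ^ (n%:Z - 4))^-1.
    rewrite -[edist x y ^ _]powR_intmul ?(ltW d0)// -powRN -powR_mulrn ?(ltW d0)// -powRrM.
    by congr (_ `^ _); rewrite rmorphB/= -pmulrn; move: nc; lra.
  by move: (1 - c) c1 (_^-1) => t t0 w; field.
Qed.

Lemma integral_sum_ord m (a : nat -> R) (g : nat -> n.-tuple R -> R) :
  (forall j, mu.-integrable setT (EFin \o g j)) ->
  mu.-integrable setT (fun y => (\sum_(j < m) a j * g j y)%:E) /\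
  \int[mu]_y (\sum_(j < m) a j * g j y) = \sum_(j < m) a j * \int[mu]_y g j y.
Proof.
move=> gi; elim: m => [|m [IH1 IH2]].
  under eq_fun do rewrite big_ord0; under eq_Rintegral do rewrite big_ord0.
  rewrite big_ord0; split; first exact: integrable0.
  by rewrite /Rintegral integral0.
under eq_fun do rewrite big_ord_recr/=; under eq_Rintegral do rewrite big_ord_recr/=.
have i1 : mu.-integrable setT (fun y => (a m * g m y)%:E).
  exact: (integrableZl measurableT (a m) (gi m)).
rewrite big_ord_recr/=; split; first exact: (integrableD measurableT IH1 i1).
by rewrite RintegralD// IH2 RintegralZl.
Qed.

End biharmonic.

(** * Expansion of the density and summation of the potentials *)

Lemma heat1E (R : realType) (c r : R) j : heat c j 1 r = lag j c r * expR (- r).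
Proof. by rewrite /heat powR1 mul1r divr1. Qed.

Theorem theorem4p1 (R : realType) (n M : nat) (n_ge3 : (3 <= n)%N)
    (M_gt1 : (1 < M)%N) (x : n.-tuple R) (x_neq0 : x <> origin n) :
  Phi M x =
    biharmonic_potential (@gaussian R n) x
    + (16 * enorm x ^+ (n - 2))^-1 * lower_gamma (n%:R / 2 - 1) (enorm x ^+ 2)
    + expR (- enorm x ^+ 2) / 16 *
      \sum_(0 <= j < M - 2)
        Laguerre j (n%:R / 2 - 1) (enorm x ^+ 2) / ((j%:R + 1) * (j%:R + 2)).
Proof.
set c : R := n%:R / 2 - 1.
have nc : n%:R / 2 = c + 1 by rewrite subrK.
have c0 : 0 < c.
  have : 3%:R <= n%:R :> R by rewrite ler_nat.
  by rewrite /c => h; lra.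
case: M M_gt1 => [//|[//|m]] _.
rewrite (_ : (m.+2 - 2 = m)%N); last by rewrite subn2.
pose mu := lebesgue_tuple n : {measure set (n.-tuple R) -> \bar R}.
have r0 := enorm_sqr_gt0 n x x_neq0.
pose P (y : n.-tuple R) := powPrim c (edist x y ^+ 2).
pose h j (y : n.-tuple R) := heat c j 1 (enorm y ^+ 2).
have hi j : mu.-integrable setT (EFin \o (fun y => h j y * P y)).
  exact: integrable_heat_powPrim.
have mh j : measurable_fun setT (h j).
  by apply: measurable_heat => //; exact: measurable_enorm_sqr.
have mP : measurable_fun setT P.
  exact: (measurableT_comp (measurable_powPrim c) (measurable_edist_sqr n x)).
(* The Gaussian is the density of index 0, so this summand of the expansion is the first term of the
   claim. *)
have Bg : biharmonic_potential (@gaussian R n) x =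
    - Gamma c / (16 * pi `^ (c + 1)) * \int[mu]_y (h 0%N y * P y).
  have -> : @gaussian R n = h 0%N by apply/funext => y; rewrite /h heat1E mul1r.
  exact: (biharmonic_potentialE n c x nc c0 (h 0%N) (mh 0%N) (hi 0%N)).
pose f (y : n.-tuple R) := Laguerre m.+1 (n%:R / 2) (enorm y ^+ 2) * gaussian y.
(* The density expanded by [lag_sum]; it agrees with [f] away from the origin. *)
pose S (y : n.-tuple R) := \sum_(j < m.+2) j`!%:R^-1 * h j y.
have fS y : y <> origin n -> S y = f y.
  move=> /(enorm_sqr_gt0 n) y0; rewrite /f LaguerreE// nc lag_sum mulr_suml.
  by apply: eq_bigr => j _; rewrite /h heat1E mulrA [_^-1 * _]mulrC.
have mS : measurable_fun setT S.
  by apply: measurable_sum => j; exact: measurable_funM.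
(* [f] differs from [S] by a multiple of the indicator of the origin. *)
have mf : measurable_fun setT f.
  have -> : f = fun y => S y + (f (origin n) - S (origin n)) * \1_[set origin n] y.
    apply/funext => y; rewrite indicE; have [yo|yo] := pselect (y = origin n).
      by rewrite yo mem_set// mulr1 addrC subrK.
    by rewrite memNset// mulr0 addr0 fS.
  apply: measurable_funD => //; apply: measurable_funM => //.
  by apply: measurable_indic; exact: measurable_tuple1.
have [iS eS] := integral_sum_ord n m.+2 (fun j => j`!%:R^-1) (fun j y => h j y * P y) hi.
have SP y : S y * P y = \sum_(j < m.+2) j`!%:R^-1 * (h j y * P y).
  by rewrite /S mulr_suml; apply: eq_bigr => j _; rewrite -mulrA.
have ifP : mu.-integrable setT (EFin \o (fun y => f y * P y)).
  apply: (integrable_off_point n (origin n) (fun y => (S y * P y)%:E)).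
  - exact: half_dim_gt0 _ _ _ nc c0.
  - by apply/measurable_EFinP; exact: measurable_funM.
  - by move=> y yo; rewrite /= fS.
  - by apply: eq_integrable iS => // y _; rewrite SP.
have -> : Phi m.+2 x = biharmonic_potential f x by [].
rewrite (biharmonic_potentialE n c x nc c0 f mf ifP).
rewrite -(Rintegral_off_point n (origin n) (fun y => S y * P y) _
  (half_dim_gt0 _ _ _ nc c0)); first last.
- by move=> y yo; rewrite fS.
- exact: measurable_funM.
- exact: measurable_funM.
under eq_Rintegral do rewrite SP.
rewrite eS big_ord_recl fact0 invr1 mul1r mulrDr -Bg -[RHS]addrA; congr (_ + _).
have p0 : 0 < pi `^ (c + 1) :> R by rewrite powR_gt0// pi_gt0.
have H j : - Gamma c / (16 * pi `^ (c + 1)) * \int[mu]_y (h j.+1 y * P y) =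
    heatp c j 1 (enorm x ^+ 2) / 16.
  have := integral_heat_powPrim n c x nc c0 j x_neq0 => e.
  rewrite mulrAC [X in X / _]e; field; rewrite gt_eqF//.
transitivity (\sum_(j < m.+1) (j.+1)`!%:R^-1 * (heatp c j 1 (enorm x ^+ 2) / 16)).
  by rewrite mulr_sumr; apply: eq_bigr => j _; rewrite lift0 mulrCA H.
(* The first derivative gives the incomplete Gamma function. In the others the index drops by two,
   and [j! / (j+2)!] becomes [1 / ((j+1)(j+2))]. *)
rewrite big_ord_recl; congr (_ + _).
  rewrite /= divr1 invr1 mul1r powRN.
  have -> : (enorm x ^+ 2) `^ c = enorm x ^+ (n - 2).
    rewrite -!powR_mulrn ?sqrtr_ge0// -powRrM natrB//; last exact: ltnW.
    by congr (_ `^ _); rewrite /c; field.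
  have e0 : enorm x ^+ (n - 2) != 0.
    by rewrite expf_neq0// -sqrf_eq0 gt_eqF.
  by field.
rewrite big_mkord mulr_sumr; apply: eq_bigr => j _ /=.
rewrite LaguerreE// heat1E /bump/= !add1n !factS !natrM.
have f0 : j`!%:R != 0 :> R by rewrite pnatr_eq0 -lt0n fact_gt0.
have -> : j.+2%:R = j%:R + 2 :> R by rewrite -addn2 natrD.
have -> : j.+1%:R = j%:R + 1 :> R by rewrite -addn1 natrD.
move: (j%:R : R) (ler0n R j) (j`!%:R : R) f0 => k k0 F F0.
have k1 : k + 1 != 0 by rewrite gt_eqF// ltr_wpDl.
have k2 : k + 2 != 0 by rewrite gt_eqF// ltr_wpDl.
by field; rewrite F0 k1 k2.
Qed.
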